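(* Let $G\in\mathcal N_2$ be a locally compact Mumford group whose center $Z(G)$ is (topologically isomorphic to) $\mathbb T$, and let $K=G/Z(G)$, so that the topological Mumford map $M_t$ is a symplectic self-duality $M_t:K\to\widehat K$. The following are equivalent: (1) $G$ is a generalized Heisenberg group (i.e. is topologically isomorphic to some topological generalized Heisenberg group); (2) $(K,M_t)$ is a standard self-duality; (3) $G$ is (topologically) isomorphic to a Mackey-Weil group $\mathbb H(E)$ for some locally compact abelian group $E$.
   Context: Locally compact groups are Hausdorff; LCA means locally compact abelian. $\mathbb T$ is the circle group, written additively. For topological groups $X$ and abelian $Y$, $Chom(X,Y)$ is the group of continuous homomorphisms $X\to Y$ with the compact-open topology, and $\widehat X=Chom(X,\mathbb T)$. $\mathcal N_2$ is the class of groups $G$ with $G/Z(G)$ abelian (equivalently $[G,G]\le Z(G)$). With $[x,y]=x^{-1}y^{-1}xy$, for a topological group $G\in\mathcal N_2$ the topological Mumford map is $M_t:G/Z(G)\to Chom(G/Z(G),Z(G))$, $M_t(xZ(G))(yZ(G))=[x,y]$, where $G/Z(G)$ has the quotient topology and $Z(G)$ the subspace topology. $G$ is a Mumford group if $M_t$ is a topological isomorphism. When $Z(G)\cong\mathbb T$, $Z(G)$ is identified with $\mathbb T$, so that $M_t$ takes values in $\widehat{K}$. A bilinear map $\omega:E\times F\to A$ of abelian groups is separated if for every $0\ne x\in E$ there is $y\in F$ with $\omega(x,y)\neq 0$ and for every $0\neq y\in F$ there is $x\in E$ with $\omega(x,y)\ne 0$. For topological abelian groups $E,F,A$ and a continuous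 separated bilinear $\omega:E\times F\to A$, the topological generalized Heisenberg group $\mathbb H(E,F,A,\omega)$ is $E\times F\times A$ with the product topology and multiplication $(x,y,z)(x',y',z')=(x+x',y+y',z+z'+\omega(x,y'))$. For an LCA group $E$, the Mackey-Weil group is $\mathbb H(E)=\mathbb H(E,\widehat E,\mathbb T,\omega)$ with $\omega(x,f)=f(x)$. A symplectic self-duality of an LCA group $K$ is a topological isomorphism $\nabla:K\to\widehat K$ with $\nabla(x)(x)=0$ for all $x\in K$. Two self-dualities $(K,\nabla)$, $(K',\nabla')$ are isomorphic if there is a topological isomorphism $\phi:K\to K'$ with $\nabla'(\phi(x))(\phi(y))=\nabla(x)(y)$ for all $x,y\in K$. For an LCA group $A$, $\nabla_A:A\times\widehat A\to\widehat{A\times\widehat A}$ is the symplectic self-duality $\nabla_A(x,f)(y,g)=g(x)-f(y)$; a symplectic self-duality is standard if it is isomorphic to $(A\times\widehat A,\nabla_A)$ for some LCA group $A$. *)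

(* Defs.v *)
From HB Require Import structures.
From mathcomp Require Import all_boot all_order all_algebra.
From mathcomp Require Import all_classical all_reals topology normedtype.

Set Implicit Arguments.
Unset Strict Implicit.
Unset Printing Implicit Defensive.

Import Order.TTheory GRing.Theory Num.Theory.
Import numFieldNormedType.Exports.

Local Open Scope classical_set_scope.
Local Open Scope ring_scope.
Local Open Scope quotient_scope.

HB.mixin Record isTopologicalGroup G & Topological G & Group G := {
  mulg_continuous : continuous (fun p : G * G => (p.1 * p.2)%g) ;
  invg_continuous : continuous (fun x : G => (x^-1)%g)
}.

#[short(type="topologicalGroupType")]
HB.structure Definition TopologicalGroup :=
  {G of Topological G & Group G & isTopologicalGroup G}.

Definition homeomorphism (X Y : topologicalType) (f : X -> Y) : Prop :=
  exists g : Y -> X, [/\ cancel f g, cancel g f, continuous f & continuous g].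

Definition group_isomorphism (G H : topologicalGroupType) (f : G -> H) : Prop :=
  {morph f : x y / (x * y)%g} /\ homeomorphism f.

Definition isomorphic_groups (G H : topologicalGroupType) : Prop :=
  exists f : G -> H, group_isomorphism f.

Definition zmod_isomorphism (A B : topologicalZmodType) (f : A -> B) : Prop :=
  {morph f : x y / x + y} /\ homeomorphism f.

Definition locally_compact_hausdorff (X : topologicalType) : Prop :=
  hausdorff_space X /\ locally_compact [set: X].

Definition abelian_group (G : groupType) : Prop := forall x y : G, commute x y.

(* A commutative topological group, written additively. *)
Section Additive.
Context (G : topologicalGroupType) (cG : abelian_group G).

Definition additive_group : Type := let _ := cG in G.

HB.instance Definition _ := Topological.copy additive_group G.

Let addA : associative (fun x y : additive_group => (x * y)%g : additive_group).
Proof. exact: (@mulgA G). Qed.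
Let addC : commutative (fun x y : additive_group => (x * y)%g : additive_group).
Proof. exact: cG. Qed.
Let add0 : left_id (1%g : additive_group)
  (fun x y : additive_group => (x * y)%g : additive_group).
Proof. exact: (@mul1g G). Qed.
Let addN : left_inverse (1%g : additive_group)
  (fun x : additive_group => (x^-1)%g : additive_group)
  (fun x y : additive_group => (x * y)%g : additive_group).
Proof. exact: (@mulVg G). Qed.

HB.instance Definition _ :=
  GRing.isZmodule.Build additive_group addA addC add0 addN.
HB.instance Definition _ := PreTopologicalNmodule_isTopologicalNmodule.Build
  additive_group (@mulg_continuous G).
HB.instance Definition _ := TopologicalNmodule_isTopologicalZmodule.Build
  additive_group (@invg_continuous G).

End Additive.

(* The library puts a topological module structure on [A * B] only for
   locally convex spaces, hence the alias. *)
Section Product.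
Context (A B : topologicalZmodType).

Definition zprod : Type := (A * B)%type.

HB.instance Definition _ := Topological.copy zprod (A * B)%type.
HB.instance Definition _ := GRing.Zmodule.copy zprod (A * B)%type.

Let zprod_sub_continuous : continuous (fun p : zprod * zprod => p.1 - p.2).
Proof.
move=> p; apply: cvg_pair => /=.
- apply: (@continuous_comp _ (A * A)%type _
    (fun p : zprod * zprod => (p.1.1, p.2.1)) (fun q : A * A => q.1 - q.2));
    last exact: sub_continuous.
  apply: cvg_pair; apply: continuous_comp; (exact: cvg_fst || exact: cvg_snd).
- apply: (@continuous_comp _ (B * B)%type _
    (fun p : zprod * zprod => (p.1.2, p.2.2)) (fun q : B * B => q.1 - q.2));
    last exact: sub_continuous.
  apply: cvg_pair; apply: continuous_comp; (exact: cvg_fst || exact: cvg_snd).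
Qed.

HB.instance Definition _ := PreTopologicalNmodule_isTopologicalZmodule.Build
  zprod zprod_sub_continuous.

End Product.

Section Center.
Context (G : topologicalGroupType).

Definition center : set G := [set z | forall x, commute z x].

Lemma center1 : center 1%g.
Proof. by move=> x; rewrite /commute mul1g mulg1. Qed.

Lemma centerM x y : center x -> center y -> center (x * y)%g.
Proof. by move=> cx cy z; rewrite /commute -mulgA cy !mulgA cx. Qed.

Lemma centerV x : center x -> center (x^-1)%g.
Proof. by move=> cx y; apply/commute_sym/commuteV/commute_sym/cx. Qed.

Definition center_group : Type := center.

HB.instance Definition _ := Topological.copy center_group (center : Type).

Definition center_elt (x : G) (cx : center x) : center_group :=
  exist _ x (mem_set cx).

Definition center_val (z : center_group) : G := val z.

Lemma center_valP (z : center_group) : center (center_val z).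
Proof. exact: set_mem (valP z). Qed.

Lemma center_val_inj : injective center_val.
Proof. exact: val_inj. Qed.

Lemma center_val_continuous : continuous center_val.
Proof. exact: initial_continuous. Qed.

Lemma continuous_to_center (X : topologicalType) (f : X -> center_group) :
  continuous (center_val \o f) -> continuous f.
Proof. by move=> cf; apply: continuous_comp_initial. Qed.

Let one := center_elt center1.
Let inv z := center_elt (centerV (center_valP z)).
Let mul z t := center_elt (centerM (center_valP z) (center_valP t)).
Let mulA : associative mul.
Proof. by move=> x y z; apply: center_val_inj; exact: mulgA. Qed.
Let mul1 : left_id one mul.
Proof. by move=> x; apply: center_val_inj; exact: mul1g. Qed.
Let mulr1 : right_id one mul.
Proof. by move=> x; apply: center_val_inj; exact: mulg1. Qed.
Let mulV : left_inverse one inv mul.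
Proof. by move=> x; apply: center_val_inj; exact: mulVg. Qed.
Let mulrV : right_inverse one inv mul.
Proof. by move=> x; apply: center_val_inj; exact: mulgV. Qed.

HB.instance Definition _ :=
  isGroup.Build center_group mulA mul1 mulr1 mulV mulrV.

Let center_mul_continuous :
  continuous (fun p : center_group * center_group => (p.1 * p.2)%g).
Proof.
apply: continuous_to_center => p.
apply: (@continuous_comp _ (G * G)%type _
  (fun p => (center_val p.1, center_val p.2)) (fun q : G * G => (q.1 * q.2)%g));
  last exact: mulg_continuous.
by apply: cvg_pair; apply: continuous_comp => /=;
  [exact: cvg_fst | exact: center_val_continuous
  |exact: cvg_snd | exact: center_val_continuous].
Qed.

Let center_inv_continuous : continuous (fun x : center_group => (x^-1)%g).
Proof.
apply: continuous_to_center => x.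
by apply: (@continuous_comp _ G _ center_val (fun y : G => (y^-1)%g));
  [exact: center_val_continuous | exact: invg_continuous].
Qed.

HB.instance Definition _ := isTopologicalGroup.Build center_group
  center_mul_continuous center_inv_continuous.

Lemma center_abelian : abelian_group center_group.
Proof. by move=> x y; apply: center_val_inj; exact: center_valP. Qed.

Definition center_rel (x y : G) : bool := `[< center (x^-1 * y)%g >].

Let center_rel_refl : reflexive center_rel.
Proof. by move=> x; apply/asboolP; rewrite mulVg; exact: center1. Qed.

Let center_rel_sym : symmetric center_rel.
Proof.
by move=> x y; apply/asboolP/asboolP => /centerV; rewrite invgM invgK.
Qed.

Let center_rel_trans : transitive center_rel.
Proof.
move=> y x z /asboolP cxy /asboolP cyz; apply/asboolP.
by have := centerM cxy cyz; rewrite -mulgA mulVKg.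
Qed.

Canonical center_equiv :=
  EquivRel center_rel center_rel_refl center_rel_sym center_rel_trans.

Definition center_quotient : Type := quotient_topology {eq_quot center_equiv}.

HB.instance Definition _ := Topological.on center_quotient.
HB.instance Definition _ := Quotient.on center_quotient.

Definition center_pi (x : G) : center_quotient := \pi_center_quotient x.

Lemma center_piP x y : center_pi x = center_pi y <-> center (x^-1 * y)%g.
Proof.
have e : (\pi_{eq_quot center_equiv} x == \pi_{eq_quot center_equiv} y)
  = center_rel x y by rewrite eqmodE.
by split=> [pxy|/asboolP]; [apply/asboolP; rewrite -/(center_rel x y) -e; apply/eqP
  | rewrite -/(center_rel x y) -e => /eqP].
Qed.

Lemma center_piK (a : center_quotient) : center_pi (repr a) = a.
Proof. exact: reprK. Qed.

Lemma repr_center_pi x : center (x^-1 * repr (center_pi x))%g.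
Proof. by apply/center_piP; rewrite center_piK. Qed.

Lemma center_pi_continuous : continuous center_pi.
Proof. exact: pi_continuous. Qed.

Lemma center_pi_open (U : set G) : open U -> open (center_pi @` U).
Proof.
move=> oU; rewrite /open /= /quotient_open.
rewrite (_ : _ @^-1` _ = \bigcup_(z in center) ((fun x => x * z)%g @^-1` U)).
  apply: bigcup_open => z _; apply: open_comp => // x _.
  apply: (@continuous_comp _ (G * G)%type _ (fun x => (x, z)) (fun q => q.1 * q.2)%g);
    last exact: mulg_continuous.
  by apply: cvg_pair; [exact: cvg_id | exact: cvg_cst].
apply/seteqP; split=> x /=.
  move=> [u Uu /esym/center_piP cxu]; exists (x^-1 * u)%g => //=.
  by rewrite mulVKg.
move=> [z cz Uxz]; exists (x * z)%g => //; apply/esym/center_piP.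
by rewrite mulKg.
Qed.

Let qmul (a b : center_quotient) := center_pi (repr a * repr b)%g.
Let qinv (a : center_quotient) := center_pi (repr a)^-1%g.

Let qmulE x y : qmul (center_pi x) (center_pi y) = center_pi (x * y)%g.
Proof.
apply/esym/center_piP; set x' := repr _; set y' := repr _.
have cx : center (x^-1 * x')%g := repr_center_pi x.
have -> : ((x * y)^-1 * (x' * y') = x^-1 * x' * (y^-1 * y'))%g.
  by rewrite invgM [RHS]mulgA cx !mulgA.
exact: centerM cx (repr_center_pi y).
Qed.

Let qinvE x : qinv (center_pi x) = center_pi x^-1%g.
Proof.
apply/center_piP; rewrite invgK; set x' := repr _.
have cx : center (x^-1 * x')%g := repr_center_pi x.
have -> : (x' / x = x^-1 * x')%g.
  by have := cx x; rewrite /commute mulVKg => {1}<-; rewrite mulgK.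
exact: cx.
Qed.

Let qmulA : associative qmul.
Proof.
move=> a b c; rewrite -[a]center_piK -[b]center_piK -[c]center_piK.
by rewrite !qmulE mulgA.
Qed.
Let qmul1 : left_id (center_pi 1%g) qmul.
Proof. by move=> a; rewrite -[a]center_piK qmulE mul1g. Qed.
Let qmulr1 : right_id (center_pi 1%g) qmul.
Proof. by move=> a; rewrite -[a]center_piK qmulE mulg1. Qed.
Let qmulV : left_inverse (center_pi 1%g) qinv qmul.
Proof. by move=> a; rewrite -[a]center_piK qinvE qmulE mulVg. Qed.
Let qmulrV : right_inverse (center_pi 1%g) qinv qmul.
Proof. by move=> a; rewrite -[a]center_piK qinvE qmulE mulgV. Qed.

HB.instance Definition _ :=
  isGroup.Build center_quotient qmulA qmul1 qmulr1 qmulV qmulrV.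

Lemma center_piM x y : center_pi (x * y)%g = (center_pi x * center_pi y)%g.
Proof. by rewrite -qmulE. Qed.

Lemma center_piV x : center_pi x^-1%g = (center_pi x)^-1%g.
Proof. by rewrite -qinvE. Qed.

Let qmul_continuous :
  continuous (fun p : center_quotient * center_quotient => (p.1 * p.2)%g).
Proof.
case=> a b W; rewrite nbhsE => -[V [oV /= Vab] VW].
rewrite -[a]center_piK -[b]center_piK -center_piM in Vab.
have /(@mulg_continuous G (repr a, repr b)) /= :
  nbhs (repr a * repr b)%g (center_pi @^-1` V).
  exact: open_nbhs_nbhs.
case=> -[A B] /= [nA nB] AB.
exists (center_pi @` A^°, center_pi @` B^°) => /=; first split.
- apply: open_nbhs_nbhs; split; first exact/center_pi_open/open_interior.
  by exists (repr a); rewrite ?center_piK.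
- apply: open_nbhs_nbhs; split; first exact/center_pi_open/open_interior.
  by exists (repr b); rewrite ?center_piK.
move=> [_ _] /= [[x /interior_subset Ax <-] [y /interior_subset By <-]].
by rewrite -center_piM; apply: VW; exact: (AB (x, y)).
Qed.

Let qinv_continuous : continuous (fun a : center_quotient => a^-1%g).
Proof.
apply/quotient_continuous.
rewrite (_ : _ \o _ = center_pi \o (fun x : G => x^-1%g)); last first.
  by apply/funext => x /=; rewrite center_piV.
move=> x; apply: continuous_comp; first exact: invg_continuous.
exact: center_pi_continuous.
Qed.

HB.instance Definition _ := isTopologicalGroup.Build center_quotient
  qmul_continuous qinv_continuous.

End Center.
Arguments center : clear implicits.
Arguments center_abelian : clear implicits.

Definition nilpotent2 (G : topologicalGroupType) : Prop :=
  abelian_group (center_quotient G).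

(* Continuous homomorphisms, topologised as a subspace of the compact-open
   function space. *)
Section Chom.
Context (X Y : topologicalZmodType).

Definition chom : Type :=
  [set f : {compact-open, X -> Y} |
    {morph f : x y / x + y} /\ continuous (f : X -> Y)].

HB.instance Definition _ := Topological.copy chom
  ([set f : {compact-open, X -> Y} |
    {morph f : x y / x + y} /\ continuous (f : X -> Y)] : Type).

Definition chom_fun (f : chom) : X -> Y := val f.
Coercion chom_fun : chom >-> Funclass.

Definition Chom (f : X -> Y) (fD : {morph f : x y / x + y})
  (fc : continuous f) : chom := exist _ f (mem_set (conj fD fc)).

Lemma chomD (f : chom) : {morph f : x y / x + y}.
Proof. by case: (set_mem (valP f)). Qed.

Lemma chom_continuous (f : chom) : continuous f.
Proof. by case: (set_mem (valP f)). Qed.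

Lemma chomP (f g : chom) : f =1 g -> f = g.
Proof. by move=> fg; apply: val_inj; apply/funext. Qed.

Let subD (f g : X -> Y) : {morph f : x y / x + y} -> {morph g : x y / x + y} ->
  {morph (fun x => f x - g x) : x y / x + y}.
Proof. by move=> fD gD x y; rewrite fD gD opprD addrACA. Qed.

Let sub_cts (f g : X -> Y) : continuous f -> continuous g ->
  continuous (fun x => f x - g x).
Proof.
move=> fc gc x.
apply: (@continuous_comp _ (Y * Y)%type _ (fun x => (f x, g x)) (fun p => p.1 - p.2));
  last exact: sub_continuous.
by apply: cvg_pair; [exact: fc|exact: gc].
Qed.

Let zero : chom.
Proof.
by apply: (@Chom (fun=> 0)) => [x y|x]; [rewrite addr0|exact: cvg_cst].
Defined.

Let sub (f g : chom) : chom :=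
  Chom (subD (@chomD f) (@chomD g))
    (sub_cts (@chom_continuous f) (@chom_continuous g)).

Let opp (f : chom) : chom := sub zero f.
Let add (f g : chom) : chom := sub f (opp g).

Let addE f g x : add f g x = f x + g x.
Proof. by change (f x - (0 - g x) = f x + g x); rewrite sub0r opprK. Qed.
Let oppE f x : opp f x = - f x.
Proof. by change (0 - f x = - f x); rewrite sub0r. Qed.

Let addA : associative add.
Proof. by move=> f g h; apply: chomP => x; rewrite !addE addrA. Qed.
Let addC : commutative add.
Proof. by move=> f g; apply: chomP => x; rewrite !addE addrC. Qed.
Let add0 : left_id zero add.
Proof. by move=> f; apply: chomP => x; rewrite addE add0r. Qed.
Let addN : left_inverse zero opp add.
Proof. by move=> f; apply: chomP => x; rewrite addE oppE addNr. Qed.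

HB.instance Definition _ := GRing.isZmodule.Build chom addA addC add0 addN.

Lemma chom_addE (f g : chom) x : (f + g : chom) x = f x + g x.
Proof. exact: addE. Qed.

Lemma chom_oppE (f : chom) x : (- f : chom) x = - f x.
Proof. exact: oppE. Qed.

Lemma chom_zeroE x : (0 : chom) x = 0.
Proof. by []. Qed.

Lemma chom_nbhs (f : chom) (K : set X) (O : set Y) :
  compact K -> open O -> f @` K `<=` O -> nbhs f [set g : chom | g @` K `<=` O].
Proof.
move=> cK oO fKO.
have c : continuous (fun f : chom => val f : {compact-open, X -> Y}).
  exact: initial_continuous.
apply: (c f [set g : X -> Y | g @` K `<=` O]).
apply: (@open_nbhs_nbhs {compact-open, X -> Y}).
by split; [exact: compact_open_open|].
Qed.

Lemma continuous_to_chom (Z : topologicalType) (h : Z -> chom) :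
  (forall z K O, compact K -> open O -> h z @` K `<=` O ->
     \forall t \near z, h t @` K `<=` O) -> continuous h.
Proof.
move=> H; apply: continuous_comp_initial => z.
by apply/compact_open_cvgP => K O cK oO hKO; exact: H.
Qed.

End Chom.

Lemma zmod_regular (Y : topologicalZmodType) : regular_space Y.
Proof.
move=> a U nU; have : nbhs (a - 0) U by rewrite subr0.
move=> /(@sub_continuous Y (a, 0)) [[A B]] /= [nA nB] AB.
exists A => // y cA.
have /cA [z [Az /= Bzy]] : nbhs y [set z | B (z - y)].
  have cy : {for y, continuous (fun z : Y => z - y)}.
    apply: (@continuous_comp _ (Y * Y)%type _ (fun z => (z, y)) (fun p => p.1 - p.2));
      last exact: sub_continuous.
    by apply: cvg_pair; [exact: cvg_id|exact: cvg_cst].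
  by apply: cy; rewrite /= subrr.
by have := AB (z, z - y) (conj Az Bzy); rewrite /= opprB addrC subrK.
Qed.

Section ChomTopology.
Context (X Y : topologicalZmodType).

Let chom_sub_continuous :
  continuous (fun p : chom X Y * chom X Y => p.1 - p.2).
Proof.
suff H (f g : chom X Y) K O : compact K -> open O ->
    (f - g : chom X Y) @` K `<=` O ->
    \forall p \near (f, g), (p.1 - p.2 : chom X Y) @` K `<=` O.
  by apply: continuous_to_chom => -[f g] K O; exact: H.
move=> cK oO fgKO.
have /near_covering_withinP/(_ _ (nbhs (f, g))
    (fun (p : chom X Y * chom X Y) x => O (p.1 x - p.2 x)) _) cov :=
  (compact_near_coveringP K).1 cK.
suff /cov : forall x, K x -> \forall x' \near x & p \near (f, g),
    K x' -> O ((p.1 : chom X Y) x' - (p.2 : chom X Y) x').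
  apply: filterS => p Kp _ [x Kx <-].
  by rewrite chom_addE chom_oppE; exact: Kp.
move=> x Kx.
have : nbhs (f x - g x) O.
  apply: open_nbhs_nbhs; split => //; apply: fgKO; exists x => //.
  by rewrite chom_addE chom_oppE.
move=> /(@sub_continuous Y (f x, g x)) [[A B]] /= [nA nB] AB.
have [A' nA' cA'A] := zmod_regular (nbhs_interior nA).
have [B' nB' cB'B] := zmod_regular (nbhs_interior nB).
have cC (h : chom X Y) (D : set Y) :
    compact (K `&` h @^-1` closure D).
  apply: compact_closedI => //; apply: closed_comp; last exact: closed_closure.
  by move=> z _; exact: chom_continuous.
have nf : nbhs (f : chom X Y) [set h : chom X Y | h @` (K `&` f @^-1` closure A') `<=` A^°].
  apply: chom_nbhs; [exact: cC|exact: open_interior|].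
  move=> _ [z [_ zA] <-]; exact: cA'A.
have ng : nbhs g [set h : chom X Y | h @` (K `&` g @^-1` closure B') `<=` B^°].
  apply: chom_nbhs; [exact: cC|exact: open_interior|].
  move=> _ [z [_ zB] <-]; exact: cB'B.
exists (f @^-1` A' `&` g @^-1` B',
  [set h : chom X Y | h @` (K `&` f @^-1` closure A') `<=` A^°] `*`
  [set h : chom X Y | h @` (K `&` g @^-1` closure B') `<=` B^°]) => /=.
  split; first by apply: filterI; apply: chom_continuous.
  by exists ([set h : chom X Y | h @` (K `&` f @^-1` closure A') `<=` A^°],
    [set h : chom X Y | h @` (K `&` g @^-1` closure B') `<=` B^°]).
move=> [y [h k]] /= [[A'y B'y] [hA kB]] Ky; apply: (AB (h y, k y)); split => /=.
- by apply: interior_subset; apply: hA; exists y => //; split=> //; exact: subset_closure.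
- by apply: interior_subset; apply: kB; exists y => //; split=> //; exact: subset_closure.
Qed.

HB.instance Definition _ := PreTopologicalNmodule_isTopologicalZmodule.Build
  (chom X Y) chom_sub_continuous.

End ChomTopology.

Lemma chom_eval_continuous (X Y : topologicalZmodType) (x : X) :
  continuous (fun f : chom X Y => f x).
Proof.
move=> f U; rewrite nbhsE => -[O [oO Ofx] OU].
have : nbhs f [set g : chom X Y | g @` [set x] `<=` O].
  by apply: chom_nbhs => //; [exact: compact_set1|move=> _ [_ -> <-]].
by apply: filterS => g gO; apply/OU/gO; exists x.
Qed.

Section ChomComp.
Context (X Y Z : topologicalZmodType) (g : chom Y Z) (f : chom X Y).

Let compD : {morph g \o f : x y / x + y}.
Proof. by move=> x y /=; rewrite !chomD. Qed.

Let comp_cts : continuous (g \o f).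
Proof.
by move=> x; apply: continuous_comp; exact: chom_continuous.
Qed.

Definition chom_comp : chom X Z := Chom compD comp_cts.

End ChomComp.

(* The circle group, as R / Z with the quotient topology. *)
Section Circle.
Context (R : realType).

Definition circle_rel (x y : R) : bool := x - y \is a Num.int.

Let circle_rel_refl : reflexive circle_rel.
Proof. by move=> x; rewrite /circle_rel subrr rpred0. Qed.

Let circle_rel_sym : symmetric circle_rel.
Proof. by move=> x y; rewrite /circle_rel -opprB rpredN. Qed.

Let circle_rel_trans : transitive circle_rel.
Proof.
by move=> y x z xy yz; have := rpredD xy yz; rewrite addrA subrK.
Qed.

Canonical circle_equiv :=
  EquivRel circle_rel circle_rel_refl circle_rel_sym circle_rel_trans.

Definition circle : Type := quotient_topology {eq_quot circle_equiv}.

HB.instance Definition _ := Topological.on circle.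
HB.instance Definition _ := Quotient.on circle.

Definition circle_pi (x : R) : circle := \pi_circle x.

Lemma circle_piP x y : circle_pi x = circle_pi y <-> x - y \is a Num.int.
Proof.
have e : (\pi_{eq_quot circle_equiv} x == \pi_{eq_quot circle_equiv} y)
  = circle_rel x y by rewrite eqmodE.
by split=> [pxy|]; [rewrite -/(circle_rel x y) -e; apply/eqP
  | rewrite -/(circle_rel x y) -e => /eqP].
Qed.

Lemma circle_piK (a : circle) : circle_pi (repr a) = a.
Proof. exact: reprK. Qed.

Lemma circle_pi_continuous : continuous circle_pi.
Proof. exact: pi_continuous. Qed.

Lemma circle_pi_open (U : set R) : open U -> open (circle_pi @` U).
Proof.
move=> oU; rewrite /open /= /quotient_open.
rewrite (_ : _ @^-1` _ =
  \bigcup_(n in [set n : R | n \is a Num.int]) ((fun x => x + n) @^-1` U)).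
  apply: bigcup_open => n _; apply: open_comp => // x _.
  by apply: cvgD; [exact: cvg_id|exact: cvg_cst].
apply/seteqP; split=> x /=.
  move=> [u Uu /circle_piP ux]; exists (u - x) => //=.
  by rewrite addrC subrK.
move=> [n nint Uxn]; exists (x + n) => //; apply/circle_piP.
by rewrite addrAC subrr add0r.
Qed.

Let add (a b : circle) := circle_pi (repr a + repr b).
Let opp (a : circle) := circle_pi (- repr a).

Let addE x y : add (circle_pi x) (circle_pi y) = circle_pi (x + y).
Proof.
apply/circle_piP; rewrite opprD addrACA.
by apply: rpredD; apply/circle_piP; rewrite circle_piK.
Qed.

Let oppE x : opp (circle_pi x) = circle_pi (- x).
Proof.
by apply/circle_piP; rewrite -opprD rpredN; apply/circle_piP; rewrite circle_piK.
Qed.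

Let addA : associative add.
Proof.
move=> a b c; rewrite -[a]circle_piK -[b]circle_piK -[c]circle_piK.
by rewrite !addE addrA.
Qed.
Let addC : commutative add.
Proof. by move=> a b; rewrite /add addrC. Qed.
Let add0 : left_id (circle_pi 0) add.
Proof. by move=> a; rewrite -[a]circle_piK addE add0r. Qed.
Let addN : left_inverse (circle_pi 0) opp add.
Proof. by move=> a; rewrite -[a]circle_piK oppE addE addNr. Qed.

HB.instance Definition _ := GRing.isZmodule.Build circle addA addC add0 addN.

Lemma circle_piD x y : circle_pi (x + y) = circle_pi x + circle_pi y.
Proof. by rewrite -addE. Qed.

Lemma circle_piN x : circle_pi (- x) = - circle_pi x.
Proof. by rewrite -oppE. Qed.

Let circle_sub_continuous : continuous (fun p : circle * circle => p.1 - p.2).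
Proof.
case=> a b W; rewrite nbhsE => -[V [oV /= Vab] VW].
rewrite -[a]circle_piK -[b]circle_piK -circle_piN -circle_piD in Vab.
have /(@sub_continuous R (repr a, repr b)) /= :
  nbhs (repr a - repr b) (circle_pi @^-1` V) by exact: open_nbhs_nbhs.
case=> -[A B] /= [nA nB] AB.
exists (circle_pi @` A^°, circle_pi @` B^°) => /=; first split.
- apply: open_nbhs_nbhs; split; first exact/circle_pi_open/open_interior.
  by exists (repr a); rewrite ?circle_piK.
- apply: open_nbhs_nbhs; split; first exact/circle_pi_open/open_interior.
  by exists (repr b); rewrite ?circle_piK.
move=> [_ _] /= [[x /interior_subset Ax <-] [y /interior_subset By <-]].
by rewrite -circle_piN -circle_piD; apply: VW; exact: (AB (x, y)).
Qed.

HB.instance Definition _ := PreTopologicalNmodule_isTopologicalZmodule.Build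
  circle circle_sub_continuous.

End Circle.

Notation dual R X := (chom X (circle R)).

Lemma continuous_pair (X Y Z : topologicalType) (f : X -> Y) (g : X -> Z) :
  continuous f -> continuous g -> continuous (fun x => (f x, g x)).
Proof. by move=> fc gc x; apply: cvg_pair; [exact: fc|exact: gc]. Qed.

Section Mumford.
Local Open Scope group_scope.
Context (G : topologicalGroupType) (hG : nilpotent2 G).

Notation Z := (additive_group (center_abelian G)).
Notation K := (additive_group hG).

Lemma comm_center (x y : G) : center G [~ x, y].
Proof.
have := hG (center_pi x) (center_pi y); rewrite /commute -!center_piM.
by move=> /esym/center_piP; rewrite invgM -mulgA.
Qed.

Lemma commMl (x y z : G) : [~ x * y, z] = [~ x, z] * [~ y, z].
Proof.
rewrite !commgEl conjMg invgM -mulgA [x^-1 * _]mulgA -commgEl.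
by rewrite [y^-1 * _]mulgA -(comm_center x z) -mulgA.
Qed.

Lemma commMr (x y z : G) : [~ x, y * z] = [~ x, y] * [~ x, z].
Proof.
by rewrite -invgR commMl invgM !invgR; apply: comm_center.
Qed.

Lemma comm_centerl (c y : G) : center G c -> [~ c, y] = 1.
Proof. by move=> cc; apply/eqP/commgP/cc. Qed.

Lemma comm_centerr (x c : G) : center G c -> [~ x, c] = 1.
Proof. by move=> cc; apply/eqP/commgP/commute_sym/cc. Qed.

Definition comm (x y : G) : Z := center_elt (comm_center x y).

Definition mumford_fun (a b : K) : Z :=
  comm (repr (a : center_quotient G)) (repr (b : center_quotient G)).

Lemma mumford_funE (x y : G) :
  mumford_fun (center_pi x) (center_pi y) = comm x y.
Proof.
apply: center_val_inj; rewrite /center_val /= /mumford_fun.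
have [cx cy] := (repr_center_pi x, repr_center_pi y).
rewrite -[repr (center_pi x)](mulVKg x) -[repr (center_pi y)](mulVKg y).
by rewrite commMl commMr (comm_centerr _ cy) (comm_centerl _ cx) !mulg1.
Qed.

Lemma quotient_piD (x y : G) :
  (center_pi (x * y) : K) = ((center_pi x : K) + (center_pi y : K))%R.
Proof. exact: center_piM. Qed.

Let mumford_funDl (b : K) : {morph mumford_fun^~ b : a a' / (a + a')%R}.
Proof.
move=> a a'; rewrite -[a]center_piK -[a']center_piK -[b]center_piK.
by rewrite -quotient_piD !mumford_funE; apply: center_val_inj; exact: commMl.
Qed.

Let mumford_funDr (a : K) : {morph mumford_fun a : b b' / (b + b')%R}.
Proof.
move=> b b'; rewrite -[a]center_piK -[b]center_piK -[b']center_piK.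
by rewrite -quotient_piD !mumford_funE; apply: center_val_inj; exact: commMr.
Qed.

Let mul_cts (X : topologicalType) (f g : X -> G) :
  continuous f -> continuous g -> continuous (fun x => f x * g x).
Proof.
move=> fc gc x.
apply: (@continuous_comp _ (G * G)%type _ (fun x => (f x, g x)) (fun p => p.1 * p.2));
  last exact: mulg_continuous.
by apply: cvg_pair; [exact: fc|exact: gc].
Qed.

Let mumford_fun_continuous (a : K) : continuous (mumford_fun a).
Proof.
apply/(@quotient_continuous G {eq_quot (center_equiv G)} (center_group G)).
apply: continuous_to_center.
pose x := repr (a : center_quotient G).
rewrite (_ : _ \o _ = (fun y : G => x^-1 * (y^-1 * (x * y)))); last first.
  apply/funext => y /=.
  by rewrite -[a]center_piK -/(center_pi y) mumford_funE.
apply: mul_cts; first by move=> y; exact: cvg_cst.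
apply: mul_cts; first exact: invg_continuous.
by apply: mul_cts; move=> y; [exact: cvg_cst|exact: cvg_id].
Qed.

Definition mumford (a : K) : chom K Z :=
  Chom (@mumford_funDr a) (@mumford_fun_continuous a).

Lemma mumfordE (x y : G) :
  center_val (mumford (center_pi x) (center_pi y)) = [~ x, y].
Proof. by rewrite -[LHS]/(center_val (mumford_fun _ _)) mumford_funE. Qed.

Lemma mumfordD : {morph mumford : a b / (a + b)%R}.
Proof.
by move=> a b; apply: chomP => c; rewrite chom_addE; exact: mumford_funDl.
Qed.

Definition mumford_group : Prop := zmod_isomorphism mumford.

(* The Mumford map read in the dual of G/Z(G) through an identification of
   the center with the circle. *)
Definition mumford_dual (R : realType) (zeta : chom Z (circle R)) (a : K) :
    dual R K :=
  chom_comp zeta (mumford a).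

End Mumford.
Arguments mumford {G} hG a.
Arguments mumford_dual {G} hG {R} zeta a.

Section Heisenberg.
Context (E F A : topologicalZmodType).

Record bilinear_form := BilinearForm {
  bform :> E -> F -> A ;
  bformDl : forall y, {morph bform^~ y : x x' / x + x'} ;
  bformDr : forall x, {morph bform x : y y' / y + y'} ;
  bform_continuous : continuous (fun p : E * F => bform p.1 p.2)
}.

Definition separated (w : bilinear_form) : Prop :=
  (forall x, x <> 0 -> exists y, w x y <> 0) /\
  (forall y, y <> 0 -> exists x, w x y <> 0).

Context (w : bilinear_form).

Definition heisenberg : Type := let _ := w in (E * F * A)%type.

HB.instance Definition _ := Topological.copy heisenberg (E * F * A)%type.

Definition heisenberg_mul (u v : heisenberg) : heisenberg :=
  let: (x, y, z) := u in let: (x', y', z') := v in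
  (x + x', y + y', z + z' + w x y').

Definition heisenberg_inv (u : heisenberg) : heisenberg :=
  let: (x, y, z) := u in (- x, - y, w x y - z).

Definition heisenberg_one : heisenberg := (0, 0, 0).

Let w0l y : w 0 y = 0.
Proof. by apply: (addrI (w 0 y)); rewrite -bformDl !addr0. Qed.
Let w0r x : w x 0 = 0.
Proof. by apply: (addrI (w x 0)); rewrite -bformDr !addr0. Qed.
Let wNl x y : w (- x) y = - w x y.
Proof. by apply: (addrI (w x y)); rewrite -bformDl !subrr w0l. Qed.
Let wNr x y : w x (- y) = - w x y.
Proof. by apply: (addrI (w x y)); rewrite -bformDr !subrr w0r. Qed.

Let mulA : associative heisenberg_mul.
Proof.
move=> [[x y] z] [[x' y'] z'] [[x'' y''] z''] /=; rewrite !addrA.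
congr (_, _, _); rewrite bformDl bformDr -!addrA; congr (_ + (_ + _)).
by rewrite [RHS]addrCA; congr (_ + _); rewrite addrC -addrA.
Qed.
Let mul1 : left_id heisenberg_one heisenberg_mul.
Proof. by move=> [[x y] z] /=; rewrite w0l !add0r addr0. Qed.
Let mulr1 : right_id heisenberg_one heisenberg_mul.
Proof. by move=> [[x y] z] /=; rewrite w0r !addr0. Qed.
Let mulV : left_inverse heisenberg_one heisenberg_inv heisenberg_mul.
Proof.
by move=> [[x y] z] /=; rewrite wNl !addNr subrK subrr.
Qed.
Let mulrV : right_inverse heisenberg_one heisenberg_inv heisenberg_mul.
Proof.
by move=> [[x y] z] /=; rewrite wNr !subrr addrCA subrr addr0 subrr.
Qed.

HB.instance Definition _ :=
  isGroup.Build heisenberg mulA mul1 mulr1 mulV mulrV.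

Let add_cts (X : topologicalType) (B : topologicalZmodType) (f g : X -> B) :
  continuous f -> continuous g -> continuous (fun x => f x + g x).
Proof.
move=> fc gc x.
apply: (@continuous_comp _ (B * B)%type _ (fun x => (f x, g x)) (fun p => p.1 + p.2));
  last exact: add_continuous.
by apply: cvg_pair; [exact: fc|exact: gc].
Qed.

Let opp_cts (X : topologicalType) (B : topologicalZmodType) (f : X -> B) :
  continuous f -> continuous (fun x => - f x).
Proof. by move=> fc x; apply: continuous_comp; [exact: fc|exact: opp_continuous]. Qed.

Let w_cts (X : topologicalType) (f : X -> E) (g : X -> F) :
  continuous f -> continuous g -> continuous (fun x => w (f x) (g x)).
Proof.
move=> fc gc x.
apply: (@continuous_comp _ (E * F)%type _ (fun x => (f x, g x)) (fun p => w p.1 p.2));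
  last exact: bform_continuous.
by apply: cvg_pair; [exact: fc|exact: gc].
Qed.

Let c1 : continuous (fun u : heisenberg => u.1.1).
Proof. by move=> u; apply: continuous_comp; exact: cvg_fst. Qed.
Let c2 : continuous (fun u : heisenberg => u.1.2).
Proof. by move=> u; apply: continuous_comp; [exact: cvg_fst|exact: cvg_snd]. Qed.
Let c3 : continuous (fun u : heisenberg => u.2).
Proof. by move=> u; exact: cvg_snd. Qed.

Let mul_continuous :
  continuous (fun p : heisenberg * heisenberg => (p.1 * p.2)%g).
Proof.
have l (X : topologicalType) (h : heisenberg -> X) : continuous h ->
    continuous (fun p : heisenberg * heisenberg => h p.1).
  by move=> hc p; apply: continuous_comp; [exact: cvg_fst|exact: hc].
have r (X : topologicalType) (h : heisenberg -> X) : continuous h ->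
    continuous (fun p : heisenberg * heisenberg => h p.2).
  by move=> hc p; apply: continuous_comp; [exact: cvg_snd|exact: hc].
rewrite (_ : (fun p => _) = (fun p : heisenberg * heisenberg =>
  (p.1.1.1 + p.2.1.1, p.1.1.2 + p.2.1.2, p.1.2 + p.2.2 + w p.1.1.1 p.2.1.2))); last first.
  by apply/funext => -[[[x y] z] [[x' y'] z']].
exact: (continuous_pair (continuous_pair (add_cts (l _ _ c1) (r _ _ c1))
  (add_cts (l _ _ c2) (r _ _ c2)))
  (add_cts (add_cts (l _ _ c3) (r _ _ c3)) (w_cts (l _ _ c1) (r _ _ c2)))).
Qed.

Let inv_continuous : continuous (fun u : heisenberg => (u^-1)%g).
Proof.
rewrite (_ : (fun u => _) = (fun u : heisenberg =>
  (- u.1.1, - u.1.2, w u.1.1 u.1.2 + - u.2))); last first.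
  by apply/funext => -[[x y] z].
exact: (continuous_pair (continuous_pair (opp_cts c1) (opp_cts c2))
  (add_cts (w_cts c1 c2) (opp_cts c3))).
Qed.

HB.instance Definition _ := isTopologicalGroup.Build heisenberg
  mul_continuous inv_continuous.

End Heisenberg.

Definition generalized_heisenberg (G : topologicalGroupType) : Prop :=
  exists (E F A : topologicalZmodType) (w : bilinear_form E F A),
    separated w /\ isomorphic_groups G (heisenberg w).

Section MackeyWeil.
Context (R : realType) (E : topologicalZmodType)
  (hE : locally_compact_hausdorff E).

Let ev (x : E) (f : dual R E) : circle R := f x.

Let evDl (f : dual R E) : {morph ev^~ f : x x' / x + x'}.
Proof. exact: chomD. Qed.

Let evDr (x : E) : {morph ev x : f f' / f + f'}.
Proof. by move=> f f'; exact: chom_addE. Qed.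

Let ev_continuous : continuous (fun p : E * dual R E => ev p.1 p.2).
Proof.
have c : continuous (uncurry (fun (f : dual R E) (x : E) => f x)).
  apply: continuous_uncurry_regular.
  - exact: hE.2.
  - exact: zmod_regular.
  - exact: (@initial_continuous _ {compact-open, E -> circle R}).
  - exact: chom_continuous.
have sw : continuous (fun p : E * dual R E => (p.2, p.1)).
  by apply: continuous_pair => p; [exact: cvg_snd|exact: cvg_fst].
move=> p; apply: (@continuous_comp _ (dual R E * E)%type _ (fun p => (p.2, p.1))
  (uncurry (fun (f : dual R E) (x : E) => f x))); [exact: sw|exact: c].
Qed.

(* Separatedness of this form is not needed to build the group; on the side
   of [E] it is the fact that characters separate points. *)
Definition evaluation_form : bilinear_form E (dual R E) (circle R) :=
  BilinearForm evDl evDr ev_continuous.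

Definition mackey_weil : topologicalGroupType := heisenberg evaluation_form.

End MackeyWeil.

Section SelfDuality.
Context (R : realType).

Definition symplectic_self_duality (K : topologicalZmodType)
    (nabla : K -> dual R K) : Prop :=
  [/\ locally_compact_hausdorff K, zmod_isomorphism nabla &
      forall x, nabla x x = 0].

Definition isomorphic_self_dualities (K K' : topologicalZmodType)
    (nabla : K -> dual R K) (nabla' : K' -> dual R K') : Prop :=
  exists phi : K -> K', zmod_isomorphism phi /\
    forall x y, nabla' (phi x) (phi y) = nabla x y.

Section StandardForm.
Context (A : topologicalZmodType).
Notation P := (zprod A (dual R A)).

Definition standard_pairing (u v : P) : circle R :=
  (v.2 : dual R A) u.1 - (u.2 : dual R A) v.1.

Let pairingD (u : P) : {morph standard_pairing u : v v' / v + v'}.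
Proof.
by move=> v v'; rewrite /standard_pairing chom_addE chomD opprD addrACA.
Qed.

Let pairing_continuous (u : P) : continuous (standard_pairing u).
Proof.
have c1 : continuous (fun v : P => (v.2 : dual R A) u.1).
  move=> v; apply: (@continuous_comp _ (dual R A) _ (fun v : P => v.2)
    (fun g : dual R A => g u.1)); [exact: cvg_snd|exact: chom_eval_continuous].
have c2 : continuous (fun v : P => (u.2 : dual R A) v.1).
  move=> v; apply: (@continuous_comp _ A _ (fun v : P => v.1) (u.2 : dual R A));
    [exact: cvg_fst|exact: chom_continuous].
move=> v; apply: (@continuous_comp _ (circle R * circle R)%type _
  (fun v : P => ((v.2 : dual R A) u.1, (u.2 : dual R A) v.1)) (fun p => p.1 - p.2));
  [exact: (continuous_pair c1 c2)|exact: sub_continuous].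
Qed.

Definition standard_map (u : P) : dual R P :=
  Chom (@pairingD u) (@pairing_continuous u).

End StandardForm.

Definition standard_self_duality (K : topologicalZmodType)
    (nabla : K -> dual R K) : Prop :=
  symplectic_self_duality nabla /\
  exists2 A : topologicalZmodType, locally_compact_hausdorff A &
    isomorphic_self_dualities nabla (@standard_map A).

End SelfDuality.

(* Main.v *)
(** The equivalence rests on the splitting of every extension of a locally
compact abelian group [A] with enough characters by the circle [T]: applied to
the preimages in [G] of the two factors of [K = A x A^], it gives lifts of [A]
and [A^] to [G] whose commutator is the evaluation, so that [G] is the
Mackey-Weil group of [A]. Conversely, if [G] is a Heisenberg group over [E]
and [F], then restricting the duality of [K = E x F] to the two factors
identifies [F] with the dual of [E].

The splitting avoids Pontryagin duality. Let [P] be an extension of [A] by [T].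
A homomorphism [P -> T] extending the identity of [T] exists abstractly, as [T]
is divisible, and it is continuous as soon as it is small near [0]. Choosing
lifts in a small neighbourhood of [0] in [P] gives a section over a
neighbourhood of [0] in [A] which is additive up to a small error. Over a
subgroup of [A] contained in that neighbourhood, the error can be removed by
the method of Hyers (the limit of [f (2 ^ n x) / 2 ^ n]). In general, finitely
many characters of [A], lifted to real coordinates, cut out near [0] a small
compact subgroup [W]; after splitting over [W], one reduces the number of
coordinates by an induction in which the group is divided by the subgroup
generated by a very small element. *)

From HB Require Import structures.
Require Import Defs.
From mathcomp Require Import all_boot all_order all_algebra.
From mathcomp Require Import all_classical all_reals topology normedtype.
From mathcomp Require Import ring lra.

Set Implicit Arguments.
Unset Strict Implicit.
Unset Printing Implicit Defensive.

Import Order.TTheory GRing.Theory Num.Theory.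
Import numFieldNormedType.Exports.

Local Open Scope classical_set_scope.
Local Open Scope ring_scope.

(** * Additive maps and neighbourhoods of the origin *)

Section AdditiveMaps.
Context (U V : zmodType) (f : U -> V) (fD : {morph f : x y / x + y}).

Lemma morphD0 : f 0 = 0.
Proof. by apply: (addrI (f 0)); rewrite -fD !addr0. Qed.

Lemma morphDN x : f (- x) = - f x.
Proof. by apply: (addrI (f x)); rewrite -fD !subrr morphD0. Qed.

Lemma morphDB x y : f (x - y) = f x - f y.
Proof. by rewrite fD morphDN. Qed.

Lemma morphDMn x n : f (x *+ n) = f x *+ n.
Proof. by elim: n => [|n IH]; rewrite ?mulr0n ?morphD0 // !mulrS fD IH. Qed.

Lemma morphDMz x m : f (x *~ m) = f x *~ m.
Proof. by case: m => n; rewrite ?NegzE ?mulrNz ?morphDN -!pmulrn morphDMn. Qed.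

Lemma morphD_sum I (r : seq I) (P : pred I) (F : I -> U) :
  f (\sum_(i <- r | P i) F i) = \sum_(i <- r | P i) f (F i).
Proof. exact: (big_morph f fD morphD0). Qed.

End AdditiveMaps.

Section TranslatedNeighbourhoods.
Context (M : topologicalZmodType).
Implicit Types (x y : M) (O : set M).

Lemma translate_nbhs x O :
  nbhs x O -> nbhs 0 [set y | O (x + y)].
Proof.
move=> nO; suff c : {for 0, continuous (fun y : M => x + y)}.
  by apply: c; rewrite addr0.
apply: (@continuous_comp _ (M * M)%type _ (fun y => (x, y)) (fun p => p.1 + p.2));
  last exact: add_continuous.
by apply: cvg_pair; [exact: cvg_cst|exact: cvg_id].
Qed.

Lemma nbhs_translate x O :
  nbhs 0 O -> nbhs x [set y | O (y - x)].
Proof.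
move=> nO; suff c : {for x, continuous (fun y : M => y - x)}.
  by apply: c; rewrite /= subrr.
apply: (@continuous_comp _ (M * M)%type _ (fun y => (y, x)) (fun p => p.1 - p.2));
  last exact: sub_continuous.
by apply: cvg_pair; [exact: cvg_id|exact: cvg_cst].
Qed.

Lemma mulrn_nbhs n O :
  nbhs 0 O -> nbhs 0 [set y | O (y *+ n)].
Proof.
move=> nO; suff c : continuous (fun y : M => y *+ n).
  by apply: c; rewrite mul0rn.
elim: n => [|n IH] x; first by rewrite (_ : (fun y => _) = fun=> 0); [exact: cvg_cst|apply/funext].
rewrite (_ : (fun y : M => y *+ n.+1) = fun y => y + y *+ n); last first.
  by apply/funext => y; rewrite mulrS.
apply: (@continuous_comp _ (M * M)%type _ (fun y => (y, y *+ n)) (fun p => p.1 + p.2));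
  last exact: add_continuous.
by apply: cvg_pair; [exact: cvg_id|exact: IH].
Qed.

End TranslatedNeighbourhoods.

Lemma morphD_continuous (M N : topologicalZmodType) (f : M -> N) :
  {morph f : x y / x + y} -> {for 0, continuous f} -> continuous f.
Proof.
move=> fD c0 x O nO.
have /c0 : nbhs (f 0) [set y | O (f x + y)].
  by rewrite (morphD0 fD); exact: translate_nbhs.
by move=> /(nbhs_translate x); apply: filterS => y /=; rewrite -fD subrKC.
Qed.

(** * Short arcs of the circle and their doublings *)

Section SmallAngles.
Context (R : realType).
Implicit Types (a b : circle R) (e t : R).

(** A closed arc around [0], measured by real angles. It is empty for negative [e], so any element
    of it yields [0 <= e]. *)
Definition small e a := exists2 t, `|t| <= e & a = circle_pi t.

Lemma circle_pi0 : circle_pi 0 = 0 :> circle R.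
Proof. exact: (morphD0 (@circle_piD R)). Qed.

Lemma circle_pi_inj t t' : `|t - t'| < 1 ->
  circle_pi t = circle_pi t' :> circle R -> t = t'.
Proof.
move=> tt' /circle_piP ti; apply/eqP; rewrite -subr_eq0.
by apply: contraTT tt' => /(norm_intr_ge1 ti); rewrite leNgt.
Qed.

Lemma small_pi t : small `|t| (circle_pi t).
Proof. by exists t. Qed.

Lemma small0 e : 0 <= e -> small e 0.
Proof. by move=> e0; exists 0; rewrite ?normr0 ?circle_pi0. Qed.

Lemma smallN e a : small e a -> small e (- a).
Proof. by move=> [t te ->]; exists (- t); rewrite ?normrN ?circle_piN. Qed.

Lemma smallD e e' a b : small e a -> small e' b -> small (e + e') (a + b).
Proof.
move=> [t te ->] [t' te' ->]; exists (t + t'); last by rewrite circle_piD.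
exact: le_trans (ler_normD _ _) (lerD te te').
Qed.

Lemma smallB e e' a b : small e a -> small e' b -> small (e + e') (a - b).
Proof. by move=> sa sb; exact/smallD/smallN. Qed.

Lemma small_le e e' a : e <= e' -> small e a -> small e' a.
Proof. by move=> ee' [t te ->]; exists t => //; exact: le_trans te ee'. Qed.

(** The angles [t + t] and [t'] of [a *+ 2] differ by at most [3 * e < 1], so they are equal and not
    only congruent modulo [1]. *)
Lemma small_half e a : e < 4^-1 -> small e a -> small e (a *+ 2) ->
  small (e / 2) a.
Proof.
move=> e4 [t te ->] [t' te']; rewrite mulr2n -circle_piD => /circle_pi_inj tt'.
move: te te' tt'; rewrite !ler_norml ltr_norml => /andP[t1 t2] /andP[t3 t4] tt'.
by exists t => //; have : t + t = t' by [apply: tt'; lra]; rewrite ler_norml; lra.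
Qed.

(** [small_half] halves the bound on every [a *+ 2 ^ j] except the last one; the induction goes on
    with [e / 2] and one doubling fewer. *)
Lemma small_multiples e a k : e < 4^-1 ->
  (forall j, (j <= k)%N -> small e (a *+ 2 ^ j)) -> small (e / 2 ^+ k) a.
Proof.
elim: k e a => [|k IH] e a e4 ha; first by rewrite divr1; have := ha 0%N isT.
have e0 : 0 <= e by have [t te _] := ha 0%N isT; exact: le_trans te.
rewrite exprS invfM mulrA; apply: IH; first by lra.
move=> j jk; apply: small_half => //; first exact/ha/leqW.
by rewrite -mulrnA -expnSr; exact: ha.
Qed.

Lemma small_eq0 a : (forall e, 0 < e -> small e a) -> a = 0.
Proof.
move=> ha; have [t t4 ae] := ha 4^-1 (ltac:(lra)); rewrite ae.
have [->|t0] := eqVneq t 0; first exact: circle_pi0.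
have tp : 0 < `|t| / 2 by rewrite divr_gt0 // normr_gt0.
have [t' t't] := ha _ tp; rewrite ae => /circle_pi_inj tt'.
have e : t = t' by apply: tt'; apply: le_lt_trans (ler_normB _ _) _; lra.
by exfalso; move: t't; rewrite -e; lra.
Qed.

Lemma half_pow_lt e d : 0 <= e -> 0 < d -> exists k, e / 2 ^+ k <= d.
Proof.
move=> e0 d0; exists (Num.truncn (e / d)).+1.
rewrite ler_pdivrMr ?exprn_gt0 // mulrC -ler_pdivrMr //.
apply: le_trans (ltW (truncnS_gt _)) _.
by rewrite -natrX ler_nat ltnW // ltn_expl.
Qed.

(** The circle has no small subgroups, in dyadic form. *)
Lemma small_multiples_eq0 e a : e < 4^-1 ->
  (forall j, small e (a *+ 2 ^ j)) -> a = 0.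
Proof.
move=> e4 ha; have e0 : 0 <= e by have [t te _] := ha 0%N; exact: le_trans te.
apply: small_eq0 => d d0; have [k kd] := half_pow_lt e0 d0.
by apply: small_le kd _; exact: small_multiples.
Qed.

Lemma small_nbhs e : 0 < e -> nbhs (0 : circle R) (small e).
Proof.
move=> e0; have sub : @circle_pi R @` ball (0 : R) e `<=` small e.
  by move=> _ [t + <-]; rewrite -ball_normE /= sub0r normrN => /ltW te; exists t.
apply: filterS sub _; apply: open_nbhs_nbhs; split.
  exact/circle_pi_open/ball_open.
by exists 0; [exact: ballxx|exact: circle_pi0].
Qed.

Lemma nbhs_small (O : set (circle R)) : nbhs 0 O ->
  exists2 e, 0 < e & small e `<=` O.
Proof.
rewrite -circle_pi0 => /(@circle_pi_continuous R 0) /nbhs_ballP [e /= e0 eO].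
exists (e / 2); first by rewrite divr_gt0.
move=> _ [t te ->]; apply: eO => /=.
by rewrite -ball_normE /= sub0r normrN; lra.
Qed.

Lemma circle_divisible n a : exists b, b *+ n.+1 = a.
Proof.
exists (circle_pi (repr a / n.+1%:R)); rewrite -(morphDMn (@circle_piD R)).
by rewrite -(mulr_natr (_ / _)) divfK ?pnatr_eq0 // circle_piK.
Qed.

Lemma circle_separated a : a <> 0 ->
  exists2 e, 0 < e & nbhs a [set b | ~ small e b].
Proof.
move=> a0; have [e e0 ae] : exists2 e, 0 < e & ~ small (e + e) a.
  apply: contra_notP a0 => ha; apply: small_eq0 => e e0.
  have e20 : 0 < e / 2 by lra.
  apply: contra_notP ha => nse; exists (e / 2) => //.
  by rewrite -splitr.
exists e => //; apply: filterS (nbhs_translate a (small_nbhs e0)) => b /= ba sb.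
by apply: ae; have -> : a = b - (b - a) by [rewrite subKr]; exact: smallB.
Qed.

(* The points whose first [k] doublings stay in the given neighbourhood are
   mapped to an arc [2 ^ k] times smaller. *)
Lemma small_continuous (M : topologicalZmodType) (f : M -> circle R) e :
  {morph f : x y / x + y} -> e < 4^-1 -> nbhs 0 (small e \o f) -> continuous f.
Proof.
move=> fD e4 nf; apply: morphD_continuous => // O; rewrite (morphD0 fD).
move=> /nbhs_small [d d0 dO].
have e0 : 0 <= e by have /= [t te _] := nbhs_singleton nf; exact: le_trans te.
have [k kd] := half_pow_lt e0 d0.
have : \forall y \near (0 : M), forall j : 'I_k.+1, small e (f (y *+ 2 ^ j)).
  by apply: filter_forall => j; exact: (mulrn_nbhs (2 ^ j) nf).
apply: filterS => y yk; apply/dO/(small_le kd)/small_multiples => // j jk.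
by rewrite -(morphDMn fD); exact: (yk (Ordinal (jk : (j < k.+1)%N))).
Qed.

Lemma circle_hausdorff : hausdorff_space (circle R).
Proof.
move=> a b ab; apply/eqP; rewrite -subr_eq0; apply/eqP/small_eq0 => e e0.
have e20 : 0 < e / 2 by lra.
have [c [ca cb]] := ab _ _ (nbhs_translate a (small_nbhs e20)) (nbhs_translate b (small_nbhs e20)).
have -> : a - b = (c - b) - (c - a) by rewrite opprB [RHS]addrC subrKA.
by rewrite [e]splitr; exact: smallB.
Qed.

End SmallAngles.

(** * Extending homomorphisms into a divisible group *)

Section Extension.
Context (Q D : zmodType) (divD : forall n (d : D), exists d', d' *+ n.+1 = d).

(** Partial homomorphisms are represented by their graphs: subgroups of [Q * D] meeting [0 * D]
    trivially. *)
Let subgroup (G : set (Q * D)) := forall u v, G u -> G v -> G (u - v).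
Let functional (G : set (Q * D)) := forall d, G (0, d) -> d = 0.

Let subgroup0 G u : subgroup G -> G u -> G 0.
Proof. by move=> sG Gu; rewrite -(subrr u); exact: sG. Qed.

Let subgroupN G u : subgroup G -> G u -> G (- u).
Proof. by move=> sG Gu; rewrite -sub0r; apply: (sG) => //; exact: subgroup0 Gu. Qed.

Let subgroupD G u v : subgroup G -> G u -> G v -> G (u + v).
Proof. by move=> sG Gu Gv; rewrite -[v]opprK; apply: (sG) => //; exact: subgroupN. Qed.

Let subgroupMz G u m : subgroup G -> G u -> G (u *~ m).
Proof.
move=> sG Gu; have Gn n : G (u *+ n).
  elim: n => [|n IH]; first by rewrite mulr0n; exact: subgroup0 Gu.
  by rewrite mulrS; exact: subgroupD.
by case: m => n; rewrite ?NegzE ?mulrNz -pmulrn //; exact: subgroupN.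
Qed.

Let pair_mulrz (u : Q * D) m : u *~ m = (u.1 *~ m, u.2 *~ m).
Proof.
have hn (n : nat) : u *+ n = (u.1 *+ n, u.2 *+ n).
  by elim: n => [|n IH] //; rewrite !mulrS IH.
by case: m => n; rewrite ?NegzE ?mulrNz -!pmulrn hn.
Qed.

Let functional_eq G x d d' : subgroup G -> functional G ->
  G (x, d) -> G (x, d') -> d = d'.
Proof.
move=> sG fG Gd Gd'; apply/eqP; rewrite -subr_eq0; apply/eqP/fG.
by rewrite -(subrr x); exact: (sG (x, d) (x, d')).
Qed.

(** Such a [d] is an admissible value at [q]. If [q *+ n.+1] is the least positive multiple in the
    domain of [G], with value [c], Euclidean division of [m] by [n.+1] shows that any solution of
    [d *+ n.+1 = c] works. *)
Let extend_value G q : subgroup G -> functional G -> G 0 ->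
  exists d, forall m y, G (q *~ m, y) -> y = d *~ m.
Proof.
move=> sG fG G0; pose dom n := `[< exists y, G (q *+ n.+1, y) >].
(* If no positive multiple of [q] lies in the domain, only [m = 0] can occur, and the value [0]
   serves. *)
have [[n0 n0P]|ndom] := pselect (exists n, dom n); last first.
  exists 0 => m y; rewrite mul0rz; have [|k|k] := intP m.
  - by rewrite mulr0z => /fG.
  - move=> Gy; case: ndom; exists k; apply/asboolP; exists y.
    by rewrite -pmulrn in Gy.
  - move=> Gy; case: ndom; exists k; apply/asboolP; exists (- y).
    by have := subgroupN sG Gy; rewrite mulrNz -pmulrn => /=; rewrite -[X in X -> _]/(G (- - _, - y)) opprK.
have [n /asboolP[c Gc] nmin] := @ex_minnP dom (ex_intro _ n0 n0P).
have [d dc] := divD n c; exists d => m y Gy.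
have mE := divz_eq m n.+1; set l := (m %/ n.+1)%Z in mE; set r := (m %% n.+1)%Z in mE.
have rE : r = m - n.+1%:Z * l by rewrite [m]mE mulrC addrAC subrr add0r.
have Gr : G (q *~ r, y - c *~ l).
  have -> : (q *~ r, y - c *~ l) = (q *~ m, y) - (q *+ n.+1, c) *~ l.
    rewrite pair_mulrz pmulrn -[RHS]/(_ - _, _ - _) -mulrzA.
    by rewrite -mulrzBr -rE.
  by apply: (sG) => //; exact: subgroupMz.
have r0 : r = 0.
  have : 0 <= r by rewrite modz_ge0.
  have : r < n.+1%:Z by rewrite ltz_pmod.
  clear rE; clearbody r; case: r mE Gr => // -[//|k] mE Gr kn _; have : (n <= k)%N.
    by apply: nmin; apply/asboolP; exists (y - c *~ l); rewrite pmulrn.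
  by move: kn; rewrite ltz_nat ltnS ltnNge => /negP kn /kn.
move: Gr; rewrite r0 mulr0z => /fG /eqP; rewrite subr_eq0 => /eqP ->.
by rewrite mE r0 addr0 -dc pmulrn -mulrzA mulrC.
Qed.

(** Divisible groups are injective: Zorn's lemma gives a maximal graph, and at any [q] outside its
    domain [extend_value] would enlarge it. *)
Lemma extend_hom (H : set Q) (f : Q -> D) : H 0 ->
  (forall x y, H x -> H y -> H (x - y) /\ f (x - y) = f x - f y) ->
  exists2 F : Q -> D, {morph F : x y / x + y} & forall x, H x -> F x = f x.
Proof.
move=> H0 HB; pose G0 : set (Q * D) := [set u | H u.1 /\ u.2 = f u.1].
have sG0 : subgroup G0.
  by move=> [x d] [y e] [/= Hx ->] [/= Hy ->]; have [? fE] := HB _ _ Hx Hy; split.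
have f0 : f 0 = 0 by have [_] := HB _ _ H0 H0; rewrite !subrr.
have fG0 : functional G0 by move=> d [_ /= ->].
(* The union with [G0] takes care of the empty chain, whose union is the empty set. *)
pose ok G := subgroup (G `|` G0) /\ functional (G `|` G0).
have [F FP totF|M [[sM fM] maxM]] := @Zorn_bigcup (Q * D)%type ok.
  have FU u v : (\bigcup_(X in F) X `|` G0) u -> (\bigcup_(X in F) X `|` G0) v ->
      (G0 u /\ G0 v) \/ exists2 X, F X & (X `|` G0) u /\ (X `|` G0) v.
    move=> [[X FX Xu]|Gu] [[Y FY Yv]|Gv]; [right|right|right|by left].
    - have [XY|YX] := totF _ _ FX FY.
        by exists Y => //; split; left => //; exact: XY.
      by exists X => //; split; left => //; exact: YX.
    - by exists X => //; split; [left|right].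
    - by exists Y => //; split; [right|left].
  split=> [u v uF vF|d dF].
    have [[Gu Gv]|[X FX [Xu Xv]]] := FU _ _ uF vF; first by right; exact: sG0.
    have [sX _] := FP _ FX.
    by have [|] := sX _ _ Xu Xv; [left; exists X|right].
  have [[Gd _]|[X FX [Xd _]]] := FU _ _ dF dF; first exact: fG0.
  by have [_ fX] := FP _ FX; exact: fX.
set M' := M `|` G0 in sM fM.
have M'0 : M' 0 by right; split.
have total q : exists d, M' (q, d).
  have [d dP] := extend_value q sM fM M'0.
  pose N : set (Q * D) := [set u | exists v m, M' v /\ u = v + (q, d) *~ m].
  have M'N : M' `<=` N by move=> v Mv; exists v, 0; rewrite mulr0z addr0.
  have NG0 : N `|` G0 = N by apply/setUidl => v Gv; apply: M'N; right.
  have okN : ok N.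
    rewrite /ok NG0; split=> [_ _ [u [m [Mu ->]]] [v [l [Mv ->]]]|e [[x y] [m [Mv]]]].
      exists (u - v), (m - l); split; first exact: sM.
      by rewrite mulrzBr opprD addrACA.
    rewrite pair_mulrz => -[/= xm ->].
    have /dP : M' (q *~ m, - y).
      have -> : q *~ m = - x by apply/eqP; rewrite -addr_eq0 addrC -xm.
      exact: (subgroupN sM Mv).
    by move=> <-; rewrite subrr.
  have [NM|nNM] := pselect (N `<=` M).
    exists d; left; apply: NM; exists 0, 1; split => //.
    by rewrite mulr1z add0r.
  case: (maxM N) => //; split=> // v Mv; apply: M'N; by left.
have [F FP] := choice total; exists F => [x y|x Hx].
  apply: (functional_eq (x := x + y) sM fM) => //.
  exact: (subgroupD sM (FP x) (FP y)).
apply: (functional_eq (x := x) sM fM) => //; by right; split.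
Qed.

End Extension.

(** * Splitting a local quasi-section *)

(* [h n] is the sum of the series [\sum_k d (n + k) / 2 ^ k.+1]. *)
Lemma halving_sequence (R : realType) (d : nat -> R) (e : R) :
  (forall n, `|d n| <= e) ->
  exists h : nat -> R, forall n, `|h n| <= e /\ h n *+ 2 = d n + h n.+1.
Proof.
move=> de; pose s n := \sum_(k < n) d k / 2 ^+ k.+1.
have e0 : 0 <= e := le_trans (normr_ge0 _) (de 0%N).
have p2 n : 0 < 2 ^+ n :> R by rewrite exprn_gt0.
have step n : e / 2 ^+ n = e / 2 ^+ n.+1 + e / 2 ^+ n.+1.
  by rewrite exprS; field; rewrite ?expf_neq0 ?pnatr_eq0.
have dn n : `|d n / 2 ^+ n.+1| <= e / 2 ^+ n.+1.
  by rewrite normrM normfV (ger0_norm (ltW (p2 _))) ler_wpM2r // invr_ge0 ltW.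
have sS n : s n.+1 = s n + d n / 2 ^+ n.+1 by rewrite /s big_ord_recr.
(* The intervals of radius [e / 2 ^+ n] around [s n] are nested; [h0], the supremum of their lower
   ends, lies in all of them. *)
have lo n : s n - e / 2 ^+ n <= s n.+1 - e / 2 ^+ n.+1.
  by rewrite sS (step n); have := dn n; rewrite ler_norml => /andP[? ?]; lra.
have hi n : s n.+1 + e / 2 ^+ n.+1 <= s n + e / 2 ^+ n.
  by rewrite sS (step n); have := dn n; rewrite ler_norml => /andP[? ?]; lra.
have lohi n m : s n - e / 2 ^+ n <= s m + e / 2 ^+ m.
  pose k := maxn n m.
  have lok := homo_leq (@lexx _ R) (@le_trans _ R) lo (leq_maxl n m).
  have hik := @homo_leq _ (fun n => s n + e / 2 ^+ n) (fun x y => y <= x) (@lexx _ R)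
    (fun y x z xy yz => le_trans yz xy) hi _ _ (leq_maxr n m).
  apply: le_trans lok (le_trans _ hik).
  by rewrite lerD2l; apply: (@le_trans _ _ 0); rewrite ?oppr_le0 divr_ge0 // ltW.
pose E : set R := range (fun n => s n - e / 2 ^+ n).
have E_ub m : ubound E (s m + e / 2 ^+ m) by move=> _ [n _ <-].
pose h0 := sup E.
have h0P n : `|h0 - s n| <= e / 2 ^+ n.
  rewrite ler_norml; apply/andP; split.
    rewrite lerBrDl; apply: (ub_le_sup (E := E)); last by exists n.
    by exists (s 0 + e / 2 ^+ 0).
  by rewrite lerBlDl; apply: ge_sup => //; exists (s 0 - e / 2 ^+ 0), 0%N.
exists (fun n => 2 ^+ n * (h0 - s n)) => n; split.
  by rewrite normrM (ger0_norm (ltW (p2 _))) mulrC -ler_pdivlMr.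
rewrite sS -(mulr_natr (_ * _)) exprS; field.
by rewrite expf_neq0 ?pnatr_eq0.
Qed.

Section CircleExtensions.
Context (R : realType) (Q : zmodType) (i : circle R -> Q).
Context (iD : {morph i : a b / a + b}).

(* [X] is a local section, up to an error [e], of the quotient of [Q] by the
   image of [i], on a set stable by the sums at which [small_at] holds. *)
Definition quasi_section (small_at : Q -> Prop) (e : R) (X : set Q) :=
  [/\ X 0, forall x, X x -> X (- x),
      forall x y, X x -> X y -> small_at (x + y) ->
        exists z a, [/\ X z, small e a & x + y = z + i a] &
      forall x y a, X x -> X y -> x = y + i a -> small e a].

(** Hyers' method on the subgroup [H], the sum of [X] and the image of [i]. The circle component [g]
    is additive on [H] up to [2 * e]. The exact homomorphism [f0] is determined by following [g]
    closely on all dyadic multiples, and it extends to [Q] because the circle is divisible. *)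
Lemma quasi_section_hom (e : R) (X : set Q) : e < 32^-1 ->
  quasi_section (fun=> True) e X ->
  exists f : Q -> circle R, [/\ {morph f : x y / x + y},
    forall a, f (i a) = a & forall x, X x -> small (3 * e) (f x)].
Proof.
move=> e32 [X0 XN XD XE]; have [i0 iN] := (morphD0 iD, morphDN iD).
have iB := morphDB iD.
have e0 : 0 <= e.
  by have [t te _] := XE 0 0 0 X0 X0 (ltac:(by rewrite i0 addr0)); exact: le_trans te.
pose H : set Q := [set q | exists x a, X x /\ q = x + i a].
have HN p : H p -> H (- p).
  by move=> [x [a [Xx ->]]]; exists (- x), (- a); rewrite opprD iN; split; first exact: XN.
have Hi a : H (i a) by exists 0, a; rewrite add0r.
have HX x : X x -> H x by move=> Xx; exists x, 0; rewrite i0 addr0.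
have /choice[g gP] : forall q, exists a, H q -> exists2 x, X x & q = x + i a.
  move=> q; have [[x [a [Xx ->]]]|nH] := pselect (H q).
    by exists a => _; exists x.
  by exists 0 => /nH.
have HD p q : H p -> H q -> H (p + q) /\ small (2 * e) (g p + g q - g (p + q)).
  move=> Hp Hq; have [[x Xx px] [y Xy qy]] := (gP _ Hp, gP _ Hq).
  have [z [a [Xz sa xyz]]] := XD x y Xx Xy I.
  have pqz : p + q = z + i (a + (g p + g q)).
    by rewrite {1}px {1}qy addrACA xyz !iD -addrA.
  have Hpq : H (p + q) by exists z, (a + (g p + g q)).
  split=> //; have [w Xw pqw] := gP _ Hpq.
  have : small e (a + (g p + g q) - g (p + q)).
    by apply: (XE w z) => //; rewrite iB addrA -pqz {1}pqw addrK.
  move=> /(smallD (smallN sa)); have -> : 2 * e = e + e by ring.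
  by rewrite -addrA addKr.
have Hpow p n : H p -> H (p *+ 2 ^ n).
  move=> Hp; elim: n => [|n IH]; rewrite ?mulr1n // expnSr mulrnA mulr2n.
  by have [] := HD _ _ IH IH.
pose shadow k p t := forall n, small k (t *+ 2 ^ n - g (p *+ 2 ^ n)).
have shadow_unique k k' p t t' : k + k' < 4^-1 ->
    shadow k p t -> shadow k' p t' -> t = t'.
  move=> kk' st st'; apply/eqP; rewrite -subr_eq0; apply/eqP.
  apply: (small_multiples_eq0 kk') => n; rewrite mulrnBl.
  by have := smallB (st n) (st' n); rewrite opprB addrA subrK.
have /choice[f0 f0P] : forall p, exists t, H p -> shadow (2 * e) p t.
  move=> p; have [Hp|] := pselect (H p); last by move=> nH; exists 0 => /nH.
  have /choice[d dP] n : exists t : R, `|t| <= 2 * e /\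
      g (p *+ 2 ^ n) *+ 2 - g (p *+ 2 ^ n.+1) = - circle_pi t.
    have [_ /smallN[t te tE]] := HD _ _ (Hpow p n Hp) (Hpow p n Hp).
    exists t; split=> //; rewrite -tE opprK expnSr mulrnA !mulr2n //.
  (* The value [t] sought at [p] satisfies [t *+ 2 ^ n = g (p *+ 2 ^ n) + circle_pi (h n)]. Since
     [d n] is the angle of the defect of [g] under doubling, this amounts to the recursion solved by
     [h]. *)
  have [h hP] := halving_sequence (fun n => (dP n).1).
  exists (g p + circle_pi (h 0%N)) => _ n; exists (h n); first by have [] := hP n.
  elim: n => [|n IH]; first by rewrite !mulr1n addrAC subrr add0r.
  apply/eqP; rewrite subr_eq; move/eqP: IH; rewrite subr_eq => /eqP IH.
  rewrite expnSr mulrnA IH mulrnDl -(morphDMn (@circle_piD R)) (hP n).2 circle_piD.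
  have /eqP := (dP n).2; rewrite subr_eq => /eqP; rewrite -expnSr => ->.
  by rewrite addrACA subrr add0r.
have f0D p q : H p -> H q -> f0 (p + q) = f0 p + f0 q.
  move=> Hp Hq; have [Hpq _] := HD _ _ Hp Hq.
  (* Uniqueness requires [2 * e + 6 * e < 4^-1]: this is the bound [e < 32^-1]. *)
  apply: (@shadow_unique (2 * e) (6 * e) (p + q)); [lra|exact: f0P|move=> n].
  have [_ s] := HD _ _ (Hpow p n Hp) (Hpow q n Hq).
  have := smallD (smallD (f0P p Hp n) (f0P q Hq n)) s.
  have -> : 2 * e + 2 * e + 2 * e = 6 * e by ring.
  by rewrite !mulrnDl [X in small _ (X + _)]addrACA -opprD addrA subrK.
have f0i a : f0 (i a) = a.
  apply: (@shadow_unique (2 * e) e (i a)); [lra|exact: f0P|move=> n].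
  rewrite -(morphDMn iD); set b := a *+ _.
  have [x Xx bx] := gP _ (Hi b).
  by apply: (XE x 0) => //; rewrite add0r iB {1}bx addrK.
have [|p q Hp Hq|f fD fE] := extend_hom (@circle_divisible R) (H := H) (f := f0).
- by rewrite -i0.
- have Hpq : H (p - q) by have [] := HD _ _ Hp (HN _ Hq).
  split=> //; apply/eqP; rewrite eq_sym subr_eq; apply/eqP.
  by rewrite -f0D // subrK.
exists f; split=> [//|a|x Xx]; rewrite fE ?f0i //; try exact: HX.
(* On [X] the value of [g] is within [e] of [0], and [f0] is within [2 * e] of [g]. *)
have Hx := HX _ Xx; have := f0P _ Hx 0%N; rewrite !mulr1n => s.
have [y Xy xy] := gP _ Hx; have := smallD s (XE _ _ _ Xx Xy xy).
by rewrite subrK; apply: small_le; lra.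
Qed.

End CircleExtensions.

(** * Induction on the number of real coordinates *)

Section LocalGeometry.
Context (R : realType) (Q : zmodType) (i : circle R -> Q).
Context (iD : {morph i : a b / a + b}).

Let small_at n (v : nat -> Q -> R) (r : R) (q : Q) :=
  forall k, (k < n)%N -> `|v k q| <= r.

Let quasi_section_ge0 P (e : R) X : quasi_section i P e X -> 0 <= e.
Proof.
move=> [X0 _ _ XE]; have [|t te _] := XE 0 0 0 X0 X0; last exact: le_trans te.
by rewrite (morphD0 iD) addr0.
Qed.

(* Either the last coordinate vanishes on the small elements of [X] and can be
   dropped, or there is a small [p] in [X] at which it does not vanish: then
   we divide by the subgroup generated by [p] and project the other coordinates
   along [p]. *)
Lemma quasi_section_local_hom n (v : nat -> Q -> R) (e r : R) (X : set Q) :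
  (forall k, {morph v k : x y / x + y}) -> (forall k a, v k (i a) = 0) ->
  3 ^+ n * e < 32^-1 -> 0 < r ->
  quasi_section i (fun q => forall k, (k < n)%N -> `|v k q| <= r) e X ->
  exists f rho, [/\ 0 < rho, {morph f : x y / x + y}, forall a, f (i a) = a &
    forall x, X x -> (forall k, (k < n)%N -> `|v k x| <= rho) ->
      small (3 ^+ n * (3 * e)) (f x)].
Proof.
elim: n v e r X => [|n IH] v e r X vD vi en r0 qX; have e0 := quasi_section_ge0 qX;
    have [X0 XN XD XE] := qX.
  have [||f [fD fi fX]] := @quasi_section_hom _ _ _ iD e X.
  - by rewrite mul1r in en.
  - by split=> // x y Xx Xy _; exact: XD.
  by exists f, 1; split=> // x Xx _; rewrite mul1r; exact: fX.
have vB k := morphDB (vD k); have vMz k := morphDMz (vD k).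
have v0 k : v k 0 = 0 := morphD0 (vD k).
have vN k x : v k (- x) = - v k x := morphDN (vD k) x.
have p3 : 0 <= 3 ^+ n * e by rewrite mulr_ge0 // exprn_ge0.
have [[rho1 rho1_gt0 Xv0]|] := pselect (exists2 rho, 0 < rho &
    forall x, X x -> small_at n.+1 v rho x -> v n x = 0).
  pose r1 := Num.min rho1 r.
  have r1_gt0 : 0 < r1 by rewrite lt_min rho1_gt0.
  have [r1rho1 r1r] : r1 <= rho1 /\ r1 <= r by rewrite !ge_min !lexx orbT.
  pose X1 := [set x | [/\ X x, v n x = 0 & small_at n v r1 x]].
  have en' : 3 ^+ n * e < 32^-1.
    by apply: le_lt_trans en; rewrite exprS -mulrA; lra.
  have [|f [rho [rho_gt0 fD fi fX]]] := IH v e r1 X1 vD vi en' r1_gt0.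
    split=> [|x [Xx vx sx]|x y [Xx vx sx] [Xy vy sy] sxy|x y a [Xx _ _] [Xy _ _]];
      last exact: XE.
    - by split=> // k _; rewrite v0 normr0 ltW.
    - by split; [exact: XN|rewrite vN vx oppr0|move=> k kn; rewrite vN normrN sx].
    - have [k kn|z [a [Xz sa xyz]]] := XD x y Xx Xy.
        move: kn; rewrite ltnS leq_eqVlt => /orP[/eqP ->|kn].
          by rewrite vD vx vy addr0 normr0 ltW.
        exact: le_trans (sxy k kn) r1r.
      have vz k : v k z = v k (x + y) by rewrite xyz [RHS]vD vi addr0.
      exists z, a; split=> //; split=> //; first by rewrite vz vD vx vy addr0.
      by move=> k kn; rewrite vz; exact: sxy.
  exists f, (Num.min rho r1); split=> // [|x Xx sx]; first by rewrite lt_min rho_gt0.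
  apply: (@small_le _ (3 ^+ n * (3 * e))).
    by rewrite exprS -mulrA; lra.
  have sx1 k : (k < n.+1)%N -> `|v k x| <= rho /\ `|v k x| <= r1.
    by move=> /sx; rewrite le_min => /andP.
  apply: fX; last by move=> k kn; have [] := sx1 k (ltnW kn).
  split=> //; last by move=> k kn; have [] := sx1 k (ltnW kn).
  by apply: Xv0 => // k /sx1[_ h]; exact: le_trans h r1rho1.
move=> nXv0; have [p [Xp sp vp]] : exists p, [/\ X p, small_at n.+1 v (r / 8) p & v n p != 0].
  apply: contra_notP nXv0 => np; exists (r / 8); first by rewrite divr_gt0.
  move=> x Xx sx; apply/eqP; apply: contra_notT np => vx; by exists x.
(* [l] is the coordinate along [p], equal to [1] at [p], and [w k] is [v k] projected along [p].
   Every [w k] vanishes at [p], and [w n] vanishes identically, which leaves [n] coordinates. *)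
pose l x := v n x / v n p.
pose w k x := v k x - l x * v k p.
have lD x y : l (x + y) = l x + l y by rewrite /l vD mulrDl.
have wD k : {morph w k : x y / x + y}.
  by move=> x y; rewrite /w vD lD mulrDl opprD addrACA.
have li a : l (i a) = 0 by rewrite /l vi mul0r.
have wi k a : w k (i a) = 0 by rewrite /w vi li mul0r subr0.
have lp m : l (p *~ m) = m%:~R by rewrite (morphDMz lD) /l divff.
have wp k m : w k (p *~ m) = 0.
  by rewrite (morphDMz (wD k)) /w /l divff // mul1r subrr mul0rz.
have vE k x : v k x = w k x + l x * v k p by rewrite subrK.
(* The bound [3] leaves room for the sum of two elements with [l] in [[-1, 1]] followed by one shift
   by [p]; then [r / 8 + 3 * (r / 8) <= r]. *)
have bound x : `|l x| <= 3 -> small_at n w (r / 8) x -> small_at n.+1 v r x.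
  move=> lx wx k; have vpk : (k < n.+1)%N -> `|l x * v k p| <= 3 * (r / 8).
    by move=> kn; rewrite normrM; apply: ler_pM => //; exact: sp.
  move=> kn; rewrite vE; apply: le_trans (ler_normD _ _) _.
  have : `|w k x| <= r / 8.
    move: (kn); rewrite ltnS leq_eqVlt => /orP[/eqP ->|/wx //].
    by rewrite /w /l divfK // subrr normr0 divr_ge0 // ltW.
  by move=> wk; have := vpk kn; lra.
have step x (m : int) : X x -> `|l x| <= 2 -> small_at n w (r / 8) x -> `|m| <= 1 ->
    exists z a, [/\ X z, small e a, x + p *~ m = z + i a &
      l z = l x + m%:~R /\ small_at n w (r / 8) z].
  move=> Xx lx wx m1.
  have Xpm : X (p *~ m).
    by move: m m1 => [[|[|m]]|[|m]] // _; exact: XN.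
  have lxm : `|l (x + p *~ m)| <= 3.
    rewrite lD lp; apply: le_trans (ler_normD _ _) _.
    have : `|m%:~R| <= 1 :> R by rewrite -intr_norm (ler_int R _ 1).
    lra.
  have wxm k : w k (x + p *~ m) = w k x by rewrite wD wp addr0.
  have [k kn|z [a [Xz sa xz]]] := XD x (p *~ m) Xx Xpm.
    by apply: bound => // j jn; rewrite wxm; exact: wx.
  exists z, a; split=> //; split.
    by rewrite -lp -lD xz [RHS]lD li addr0.
  by move=> k kn; have := wxm k; rewrite xz wD wi addr0 => ->; exact: wx.
(* Division by the subgroup generated by [p] is expressed by making [X'] stable under translation by
   multiples of [p], with representatives normalised by the bound on [l x]. *)
pose X' := [set q | exists x m, [/\ X x, `|l x| <= 1, small_at n w (r / 8) x & q = x + p *~ m]].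
have [|||f [rho [rho_gt0 fD fi fX]]] := IH w (3 * e) (r / 8) X' wD wi.
- by rewrite mulrA -exprSr.
- by rewrite divr_gt0.
- split.
  + exists 0, 0; rewrite mulr0z addr0 (morphD0 lD) normr0; split=> // k _.
    by rewrite (morphD0 (wD k)) normr0 divr_ge0 // ltW.
  + move=> _ [x [m [Xx lx wx ->]]]; exists (- x), (- m).
    rewrite opprD mulrNz (morphDN lD) normrN; split=> //; first exact: XN.
    by move=> k kn; rewrite (morphDN (wD k)) normrN; exact: wx.
  + move=> _ _ [x [m [Xx lx wx ->]]] [y [m' [Xy ly wy ->]]] sxy.
    have wxy : small_at n w (r / 8) (x + y).
      by move=> k /sxy; rewrite addrACA -mulrzDr (wD k (x + y)) wp addr0.
    have lxy : `|l (x + y)| <= 2.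
      by rewrite lD; apply: le_trans (ler_normD _ _) _; lra.
    have [|z [a [Xz sa xyz]]] := XD x y Xx Xy.
      by apply: bound wxy; lra.
    have lz : l z = l (x + y) by rewrite xyz [RHS]lD li addr0.
    have wz : small_at n w (r / 8) z.
      by move=> k /wxy; rewrite xyz wD wi addr0.
    (* The value of [l] at the sum is at most [2] in norm; one shift by [p], at the cost of a second
       [e], brings it back to [[-1, 1]]. *)
    have [c c1 lzc] : exists2 c : int, `|c| <= 1 & `|l z + c%:~R| <= 1.
      move: lxy; rewrite -lz; case: (lerP (l z) (-1)) => l1.
        by exists 1 => //; move: lxy; rewrite !ler_norml => /andP[? ?]; lra.
      case: (lerP (l z) 1) => l2; first by exists 0 => //; rewrite addr0 ler_norml; lra.
      by exists (-1) => //; move: lxy; rewrite !ler_norml => /andP[? ?]; lra.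
    have lz2 : `|l z| <= 2 by rewrite lz.
    have [z' [b [Xz' sb zz' [lz' wz']]]] := step z c Xz lz2 wz c1.
    exists (z' + p *~ (m + m' - c)), (a + b); split.
    * by exists z', (m + m' - c); split=> //; rewrite lz'.
    * by apply: small_le (smallD sa sb); lra.
    * have zE : z = z' + i b - p *~ c by rewrite -zz' addrK.
      rewrite addrACA -mulrzDr xyz zE mulrzBr iD -!addrA; congr (_ + _).
      by rewrite [LHS]addrC -!addrA [RHS]addrCA; congr (_ + _); exact: addrCA.
  + move=> _ _ a [x [m [Xx lx wx ->]]] [y [m' [Xy ly wy ->]]] xya.
    have xy : x + p *~ (m - m') = y + i a.
      by rewrite mulrzBr addrA xya addrAC addrK.
    have lm : l x + (m - m')%:~R = l y by rewrite -lp -lD xy lD li addr0.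
    (* Two representatives of one element differ by at most two shifts. Two shifts and one
       comparison in [X] cost [3 * e], the factor gained at each induction step. *)
    have [c1 [c2 [c1_1 c2_1 mE]]] : exists c1 c2 : int, [/\ `|c1| <= 1, `|c2| <= 1 & m - m' = c1 + c2].
      have : `|m - m'| <= 2.
        rewrite -(ler_int R) intr_norm; move: lm lx ly; rewrite !ler_norml => lm /andP[? ?] /andP[? ?]; lra.
      move: (m - m') => [[|[|[|c]]]|[|[|c]]] // _.
      - by exists 0, 0.
      - by exists 1, 0.
      - by exists 1, 1.
      - by exists (-1), 0.
      - by exists (-1), (-1).
    have lx2 : `|l x| <= 2 by lra.
    have [z1 [a1 [Xz1 sa1 xz1 [lz1 wz1]]]] := step x c1 Xx lx2 wx c1_1.
    have lz12 : `|l z1| <= 2.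
      rewrite lz1; apply: le_trans (ler_normD _ _) _.
      have : `|c1%:~R| <= 1 :> R by rewrite -intr_norm (ler_int R _ 1).
      lra.
    have [z2 [a2 [Xz2 sa2 xz2 _]]] := step z1 c2 Xz1 lz12 wz1 c2_1.
    have yz2 : y = z2 + i (a1 + a2 - a).
      apply: (addIr (i a)); rewrite -xy mE mulrzDr addrA xz1 addrAC xz2.
      by rewrite (morphDB iD) addrA subrK iD [i a1 + _]addrC addrA.
    have := smallB (smallD sa1 sa2) (XE _ _ _ Xy Xz2 yz2).
    by rewrite subKr; apply: small_le; lra.
have vp0 : 0 < `|v n p| by rewrite normr_gt0.
pose mu := Num.min rho (r / 8).
have mu0 : 0 < mu by rewrite lt_min rho_gt0 divr_gt0.
(* With this [t], bounding all [v k x] by [mu / t] bounds the projected coordinates [w k x] by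
   [mu]. *)
pose t := 1 + r / 8 / `|v n p|.
have t0 : 0 < t by rewrite addr_gt0 // !divr_gt0.
exists f, (Num.min `|v n p| (mu / t)); split=> // [|x Xx sx].
  by rewrite lt_min vp0 divr_gt0.
have sx1 k : (k < n.+1)%N -> `|v k x| <= `|v n p| /\ `|v k x| <= mu / t.
  by move=> /sx; rewrite le_min => /andP.
have lx : `|l x| * `|v n p| <= mu / t.
  by rewrite -normrM divfK //; have [] := sx1 n (ltnSn n).
have wx k : (k < n)%N -> `|w k x| <= mu.
  move=> kn; apply: le_trans (ler_normB _ _) _; rewrite normrM.
  have -> : mu = mu / t + mu / t / `|v n p| * (r / 8).
    rewrite -mulrA [_^-1 * _]mulrC -[X in X + _]mulr1 -mulrDr -/t.
    by rewrite divfK // gt_eqF.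
  apply: lerD; first by have [] := sx1 k (ltnW kn).
  by apply: ler_pM => //; [rewrite ler_pdivlMr|exact/sp/ltnW].
have wx1 k : (k < n)%N -> `|w k x| <= rho /\ `|w k x| <= r / 8.
  by move=> /wx; rewrite le_min => /andP.
rewrite exprSr -mulrA; apply: fX; last by move=> k /wx1[].
exists x, 0; split=> //; last by rewrite mulr0z addr0.
  rewrite /l normrM normfV ler_pdivrMr // mul1r.
  by have [] := sx1 n (ltnSn n).
by move=> k /wx1[].
Qed.

End LocalGeometry.

(** * Extensions of locally compact abelian groups by the circle *)

Lemma symmetric_nbhs3 (M : topologicalZmodType) (N : set M) : nbhs 0 N ->
  exists V, [/\ nbhs 0 V, V `<=` N, forall x, V x -> V (- x) &
    forall x y z, V x -> V y -> V z -> N (x + y + z)].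
Proof.
have sub2 (O : set M) : nbhs 0 O ->
    exists2 V, nbhs 0 V & forall x y, V x -> V y -> O (x - y).
  rewrite -{1}[0](subrr 0) => /(@sub_continuous M (0, 0)) [[B C]] /= [nB nC] BC.
  exists (B `&` C); first exact: filterI.
  by move=> x y [Bx _] [_ Cy]; exact: (BC (x, y)).
move=> /sub2[V nV VN]; have [W nW WV] := sub2 _ nV; have [Y nY YW] := sub2 _ nW.
have [W0 Y0] := (nbhs_singleton nW, nbhs_singleton nY).
have YV y : Y y -> V y by move=> Yy; rewrite -[y]subr0 -[y]subr0; apply: (WV) => //; exact: YW.
have nYN : nbhs 0 [set y | Y (- y)].
  suff c : {for 0, continuous (fun y : M => - y)} by apply: c; rewrite /= oppr0.
  exact: opp_continuous.
exists (Y `&` [set y | Y (- y)]); split.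
- exact: filterI.
- by move=> y [Yy _]; rewrite -[y]subr0; apply: VN; exact: YV.
- by move=> y [Yy Yny]; split=> //=; rewrite opprK.
move=> x y z [Yx _] [_ Yny] [Yz Ynz]; rewrite -[z]opprK; apply: VN; last exact: YV.
by rewrite -[x + y]subr0 -[y]opprK; apply: WV => //; exact: YW.
Qed.

Lemma symmetric_compact_nbhs (M : topologicalZmodType) (N : set M) :
  locally_compact [set: M] -> nbhs 0 N ->
  exists K, [/\ nbhs 0 K, K `<=` N, forall x, K x -> K (- x) & compact K].
Proof.
move=> lcM nN; have [//|C] := lcM 0; rewrite withinET => nC [cC clC].
have cN : continuous (fun y : M => - y) by exact: opp_continuous.
have [B nB BN] := zmod_regular nN.
have nNB : nbhs 0 [set y | closure B (- y)].
  have : nbhs (0 : M) (closure B) by exact: filterS (@subset_closure _ B) nB.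
  by rewrite -{1}(oppr0 M) => /(cN 0).
have nNC : nbhs 0 [set y | C (- y)].
  by move: nC; rewrite -{1}(oppr0 M) => /(cN 0).
exists (C `&` ((closure B `&` [set y | closure B (- y)]) `&` [set y | C (- y)])); split.
- apply: filterI => //; apply: filterI => //; apply: filterI => //.
  exact: filterS (@subset_closure _ B) nB.
- by move=> y [_ [[By _] _]]; exact: BN.
- by move=> y [Cy [[By Bny] Cny]]; split=> //; split; [split|]; rewrite /= ?opprK.
apply: compact_closedI => //; have clN (D : set M) : closed D -> closed [set y | D (- y)].
  by move=> clD; apply: (closed_comp (f := fun y : M => - y)) => // y _; exact: cN.
by apply: closedI; [apply: closedI; [|apply: clN]; exact: closed_closure|exact: clN].
Qed.

(** * Finitely many characters near the origin *)

Section Characters.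
Context (R : realType) (A : topologicalZmodType).
Context (lcA : locally_compact [set: A]).
Context (sepA : forall a : A, a <> 0 -> exists f : dual R A, f a <> 0).

(** Compactness of [K], with respect to the filter of large finite lists of characters: each point
    of [K] outside [O] is excluded, together with a neighbourhood, by a single character. *)
Lemma finitely_many_characters (K O : set A) : compact K -> open O -> O 0 ->
  exists s : seq (dual R A), forall a, K a ->
    (forall f : dual R A, f \in s -> small 8^-1 (f a)) -> O a.
Proof.
move=> cK oO O0.
pose G (S : set (seq (dual R A))) :=
  exists s0 : seq (dual R A), forall s : seq (dual R A), {subset s0 <= s} -> S s.
pose good (s : seq (dual R A)) a := (forall f : dual R A, f \in s -> small 8^-1 (f a)) -> O a.
have GF : Filter G.
  split=> [|S T [s sS] [t tT]|S T ST [s sS]]; first by exists [::].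
    exists (s ++ t) => u stu; split; [apply: sS|apply: tT] => f fs;
      by apply: stu; rewrite mem_cat fs ?orbT.
  by exists s => u /sS /ST.
have /compact_near_coveringP/(_ _ G good GF) := cK.
case=> [a Ka|s /(_ s)]; last by move=> sK; exists s => a; exact: sK.
have [Oa|Oa] := pselect (O a).
  exists (O, setT) => /=; last by move=> [b s] [/= Ob _] _.
  by split; [exact: open_nbhs_nbhs|exact: filterT].
(* Some dyadic multiple of a character that is nonzero at [a] leaves the arc of radius [5^-1]; the
   gap between [5^-1] and [8^-1] gives a neighbourhood of [a]. *)
have [f fa] : exists f : dual R A, ~ small 5^-1 (f a).
  have [|f0 f0a] := sepA (a := a); first by move=> a0; apply: Oa; rewrite a0.
  apply: contra_notP f0a => nf; apply: (@small_multiples_eq0 _ 5^-1); first by lra.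
  move=> j; apply: contra_notP nf => nj; exists (f0 *+ 2 ^ j).
  suff -> : (f0 *+ 2 ^ j : dual R A) a = f0 a *+ 2 ^ j by [].
  by rewrite (@morphDMn _ _ (fun f : dual R A => f a)) // => f g; exact: chom_addE.
have e0 : 0 < 5^-1 - 8^-1 :> R by lra.
exists ([set b | small (5^-1 - 8^-1) (f b - f a)], [set s : seq (dual R A) | f \in s]) => /=.
  split; first exact: (@chom_continuous _ _ f a _ (nbhs_translate (f a) (small_nbhs e0))).
  by exists [:: f] => s; apply; rewrite inE.
move=> [b s] /= [fab fs] sb; case: fa; rewrite -(subKr (f b) (f a)).
by apply: small_le (smallB (sb f fs) fab); lra.
Qed.

(** The characters in [s] are such that the points of [K] where they are small lie in some [V] with
    [V + V + V] inside [K]. With [e = 0], the common kernel of [s] in [K] is a subgroup. *)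
Lemma local_characters (U : set A) : nbhs 0 U ->
  exists (s : seq (dual R A)) (K : set A),
    [/\ nbhs 0 K, K `<=` U, forall x, K x -> K (- x), compact K &
      forall e x y, e <= 8^-1 -> K x -> K y ->
        (forall f : dual R A, f \in s -> small e (f x)) ->
        (forall f : dual R A, f \in s -> small e (f y)) -> K (x + y)].
Proof.
move=> nU; have [K [nK KU KN cK]] := symmetric_compact_nbhs lcA nU.
have [V [nV _ VN VK]] := symmetric_nbhs3 nK.
have [s sP] := finitely_many_characters cK (open_interior V) nV.
have V0 := nbhs_singleton nV.
exists s, K; split=> // e x y e8 Kx Ky sx sy; rewrite -[x + y]addr0.
apply: VK => //; apply: interior_subset; apply: sP => // f fs.
- exact: small_le e8 (sx f fs).
- exact: small_le e8 (sy f fs).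
Qed.

(** By compactness: a point of [K] outside the common kernel has a neighbourhood on which one
    character stays away from [0], and a point [a] of the kernel serves as [b] for its
    neighbours. *)
Lemma near_kernel (s : seq (dual R A)) (K V : set A) : compact K -> nbhs 0 V ->
  exists2 e, 0 < e & forall a, K a ->
    (forall f : dual R A, f \in s -> small e (f a)) ->
    exists b, [/\ K b, forall f : dual R A, f \in s -> f b = 0 & V (a - b)].
Proof.
move=> cK nV.
pose good (e : R) a := (forall f : dual R A, f \in s -> small e (f a)) ->
  exists b, [/\ K b, forall f : dual R A, f \in s -> f b = 0 & V (a - b)].
have cov : forall a, K a -> \forall a' \near a & e \near 0^'+, K a' -> good e a'.
  move=> a Ka; have [[f fs fa]|nf] := pselect (exists2 f : dual R A, f \in s & f a <> 0).
    have [d d0 nd] := circle_separated fa.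
    exists ([set b | ~ small d (f b)], [set e | e <= d]) => /=.
      split; first exact: (@chom_continuous _ _ f a _ nd).
      exact: nbhs_right_le.
    move=> [b e] /= [nb ed] _ sb; case: nb; exact: small_le (sb f fs).
  exists ([set b | V (b - a)], setT) => /=.
    by split; [exact: nbhs_translate|exact: filterT].
  move=> [b e] /= [Vb _] _ _; exists a; split=> // f fs.
  by apply: contrapT => fa; apply: nf; exists f.
have /near_covering_withinP/(_ _ _ good _ cov) ncov := (compact_near_coveringP K).1 cK.
have [e [e0 Ke]] := filter_ex (filterI (nbhs_right_gt (0 : R)) ncov).
by exists e => // a Ka; exact: Ke.
Qed.

End Characters.

(** * Splitting an extension by the circle *)

Section Splitting.
Context (R : realType) (P A : topologicalZmodType).
Context (i : circle R -> P) (pr : P -> A).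
Context (iD : {morph i : a b / a + b}) (prD : {morph pr : x y / x + y}).
Context (pr_open : forall U, open U -> open (pr @` U)) (pr_cts : continuous pr).
Context (pr_surj : forall a, exists p, pr p = a).
Context (pr_i : forall t, pr (i t) = 0) (pr_ker : forall p, pr p = 0 -> exists t, p = i t).
Context (i_embedding : forall e, 0 < e -> nbhs 0 [set p | forall t, p = i t -> small e t]).
Context (lcA : locally_compact [set: A]).
Context (sepA : forall a : A, a <> 0 -> exists f : dual R A, f a <> 0).

Let pr0 : pr 0 = 0 := morphD0 prD.
Let prN := morphDN prD.
Let prB := morphDB prD.

Let pr_nbhs (V : set P) : nbhs 0 V -> nbhs 0 (pr @` V).
Proof.
move=> nV; apply: (@filterS _ _ _ (pr @` V°)).
  by apply: image_subset; exact: interior_subset.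
apply: open_nbhs_nbhs; split; first exact/pr_open/open_interior.
by exists 0.
Qed.

(** As [W] is a subgroup, the elements of [V] above [W] form a quasi-section without coordinates, to
    which Hyers' method applies. *)
Let split_small_subgroup e (V : set P) (W : set A) : e < 32^-1 ->
  V 0 -> (forall x, V x -> V (- x)) ->
  (forall x y z t, V x -> V y -> V z -> x + y + z = i t -> small e t) ->
  W 0 -> (forall a b, W a -> W b -> W (a - b)) -> W `<=` pr @` V ->
  exists f : P -> circle R, [/\ {morph f : x y / x + y}, forall a, f (i a) = a &
    forall x, V x -> W (pr x) -> small (3 * e) (f x)].
Proof.
move=> e32 V0 VN Ve W0 WB WV.
have WN a : W a -> W (- a) by move=> Wa; rewrite -sub0r; exact: WB.
have [|f [fD fi fX]] := @quasi_section_hom _ _ i iD e [set x | V x /\ W (pr x)] e32.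
  split=> [|x [Vx Wx]|x y [Vx Wx] [Vy Wy] _|x y a [Vx Wx] [Vy Wy] xya].
  - by rewrite /= pr0.
  - by split; [exact: VN|rewrite /= prN; exact: WN].
  - have /WV[z Vz zE] : W (pr (x + y)).
      by rewrite prD -[pr y]opprK; apply: (WB) => //; exact: WN.
    have [t tE] : exists t, x + y - z = i t.
      by apply: pr_ker; rewrite prB zE subrr.
    exists z, t; split; last by rewrite -tE subrKC.
      split=> //=; rewrite zE prD -[pr y]opprK; apply: (WB) => //; exact: WN.
    by apply: (Ve x y (- z)) => //; exact: VN.
  - by apply: (Ve x (- y) 0) => //; [exact: VN|rewrite addr0 xya addrAC subrr add0r].
by exists f; split=> // x Vx Wx; exact: fX.
Qed.

Lemma circle_extension_splits :
  exists f : chom P (circle R), forall t, f (i t) = t.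
Proof.
have [e1 e1_gt0 e1_lt] : exists2 e : R, 0 < e & e < 32^-1 by exists 64^-1; lra.
have e1_4 : 3 * e1 < 4^-1 by lra.
have lt64 : 64^-1 < 32^-1 :> R by lra.
have le16 : 3 * 64^-1 + 64^-1 <= 16^-1 :> R by lra.
have lt16 : 16^-1 < 4^-1 :> R by lra.
have [V [nV _ VN VE]] := symmetric_nbhs3 (i_embedding e1_gt0).
have V0 := nbhs_singleton nV.
have [s' [K [nK KV KN cK KD]]] := local_characters lcA sepA (pr_nbhs nV).
have [s us ss'] : exists2 s, uniq s & s =i s'.
  by exists (undup s'); [exact: undup_uniq|exact: mem_undup].
have K0 := nbhs_singleton nK.
pose W := [set a | K a /\ forall f : dual R A, f \in s -> f a = 0].
have W0 : W 0 by split=> // f _; exact: (morphD0 (chomD f)).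
have WB a b : W a -> W b -> W (a - b).
  move=> [Ka Wa] [Kb Wb]; split; last first.
    by move=> f fs; rewrite (morphDB (chomD f)) Wa // Wb // subrr.
  apply: (KD 0); [by lra|by []|exact: KN| |].
    by move=> f; rewrite -ss' => fs; rewrite Wa //; exact: small0.
  move=> f; rewrite -ss' => fs; rewrite (morphDN (chomD f)) Wb // oppr0.
  exact: small0.
have WV : W `<=` pr @` V by move=> a [/KV].
have [|f0 [f0D f0i f0V]] := split_small_subgroup e1_lt V0 VN _ W0 WB WV.
  by move=> x y z t Vx Vy Vz; exact: VE.
have WN a : W a -> W (- a) by move=> Wa; rewrite -sub0r; exact: WB.
have WMn a m : W a -> W (a *+ m).
  move=> Wa; elim: m => [|m IH] //.
  by rewrite mulrSr -[X in _ + X]opprK; apply: (WB) => //; exact: WN.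
(* [S] is the copy of [W] in [P] given by the splitting [f0]. *)
pose S := [set p | W (pr p) /\ f0 p = 0].
have SB p q : S p -> S q -> S (p - q).
  by move=> [Wp p0] [Wq q0]; split; [rewrite /= prB; exact: WB|rewrite /= (morphDB f0D) p0 q0 subrr].
have S0 : S 0 by split; rewrite /= ?pr0 ?(morphD0 f0D).
have SN p : S p -> S (- p) by move=> Sp; rewrite -sub0r; exact: SB.
(* The induction on [n] coordinates multiplies errors by [3 ^+ n], so [e] is taken small enough
   beforehand. *)
pose n := size s; have [e e_gt0 e3] : exists2 e : R, 0 < e & 3 ^+ n * e = 64^-1.
  have p3 : 0 < 3 ^+ n :> R by rewrite exprn_gt0.
  exists (64^-1 / 3 ^+ n); first by rewrite divr_gt0 // invr_gt0.
  by rewrite mulrC divfK // gt_eqF.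
(* [k] halvings bring the bound [3 * e1] on [f0] below [e]; [V2] is therefore chosen so that sums of
   three of its elements stay in [V] during [k] doublings. *)
have [k kP] := half_pow_lt (mulr_ge0 (ler0n R 3) (ltW e1_gt0)) e_gt0.
have nN : nbhs 0 [set p | forall j : 'I_k.+1, V (p *+ 2 ^ j)].
  by apply: filter_forall => j; exact: (mulrn_nbhs (2 ^ j) nV).
have [V2 [nV2 V2N V2opp V2D]] := symmetric_nbhs3 nN.
have V20 := nbhs_singleton nV2.
(* [f0] kills [S] and is the identity on the circle, so [t = f0 (x + y + z)]; all the doublings of
   [x + y + z] up to [k] lie in [V] and above [W]. *)
have V2S x y z p t : V2 x -> V2 y -> V2 z -> S p -> x + y + z + p = i t -> small e t.
  move=> Vx Vy Vz [Wp p0] xyz; have Nx := V2D _ _ _ Vx Vy Vz; set q := x + y + z in xyz Nx.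
  have -> : t = f0 q by rewrite -[t]f0i -xyz f0D p0 addr0.
  have Wq : W (pr q).
    have -> : pr q = 0 - pr p by rewrite -(pr_i t) -xyz (prD q p) addrK.
    exact: WB.
  apply: small_le kP _; apply: small_multiples => // j jk.
  rewrite -(morphDMn f0D); apply: f0V; first exact: (Nx (Ordinal (jk : (j < k.+1)%N))).
  by rewrite (morphDMn prD); exact: WMn.
have [r0 r0_gt0 Kr0] := near_kernel s cK (pr_nbhs nV2).
have [r [r_gt0 rr0 r8]] : exists r : R, [/\ 0 < r, r <= r0 & r <= 8^-1].
  exists (Num.min r0 8^-1); rewrite lt_min r0_gt0 invr_gt0 ltr0n.
  by rewrite !ge_min !lexx orbT.
(* Elements of [P] are paired with candidate real angles for the values of characters; only the
   coordinates in [s] matter, and [X] requires them to be true angles of size at most [r]. *)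
pose Q := (P * (dual R A -> R))%type.
pose j a : Q := (i a, 0).
have jD : {morph j : a b / a + b} by move=> a b; apply: injective_projections => /=; [exact: iD|rewrite addr0].
pose v (l : nat) (q : Q) : R := q.2 (nth 0 s l).
have vD l : {morph v l : x y / x + y} by [].
have vj l a : v l (j a) = 0 by [].
pose V2S' := [set p | exists x q, [/\ V2 x, S q & p = x + q]].
pose lift (rho : R) (q : Q) := forall f : dual R A, f \in s ->
  f (pr q.1) = circle_pi (q.2 f) /\ `|q.2 f| <= rho.
pose X : set Q := [set q | [/\ V2S' q.1, K (pr q.1) & lift r q]].
have lift_small rho q : lift rho q -> forall f : dual R A, f \in s -> small rho (f (pr q.1)).
  by move=> lq f /lq[-> ?]; exists (q.2 f).
have V2S'N p : V2S' p -> V2S' (- p).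
  move=> [x [q [Vx Sq ->]]]; exists (- x), (- q).
  by rewrite opprD; split=> //; [exact: V2opp|exact: SN].
have V2S'3 x y z t : V2S' x -> V2S' y -> V2S' z -> x + y + z = i t -> small e t.
  move=> [a [p [Va Sp ->]]] [b [p' [Vb Sp' ->]]] [c [p'' [Vc Sp'' ->]]] xyz.
  apply: (V2S a b c (p + p' + p'')) => //; last first.
    by rewrite -xyz [LHS]addrACA; congr (_ + _); exact: addrACA.
  by rewrite -[p'']opprK -[p']opprK; apply: (SB); [apply: (SB)|]; rewrite ?opprK //; exact: SN.
have Ks x y : K x -> K y -> (forall f : dual R A, f \in s -> small r (f x)) ->
    (forall f : dual R A, f \in s -> small r (f y)) -> K (x + y).
  by move=> Kx Ky sx sy; apply: (KD r) => // f; rewrite -ss'; [exact: sx|exact: sy].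
have qX : quasi_section j (fun q => forall l, (l < n)%N -> `|v l q| <= r) e X.
  split.
  - split; [by exists 0, 0; rewrite addr0|by rewrite pr0|move=> f fs].
    by rewrite pr0 (morphD0 (chomD f)) circle_pi0 normr0 ltW.
  - move=> [p x] [/= Sp Kp lp]; split=> /=; [exact: V2S'N|by rewrite prN; exact: KN|move=> f fs].
    have [fp xf] := lp f fs.
    by rewrite /= prN (morphDN (chomD f)) fp circle_piN normrN.
  - move=> [p x] [q y] [/= Sp Kp lp] [/= Sq Kq lq] vxy.
    have Kpq : K (pr p + pr q) by apply: Ks => //; [exact: lift_small lp|exact: lift_small lq].
    have lpq : forall f : dual R A, f \in s ->
        f (pr p + pr q) = circle_pi (x f + y f) /\ `|x f + y f| <= r.
      move=> f fs; have [[fp _] [fq _]] := (lp f fs, lq f fs).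
      split; first by rewrite (chomD f) fp fq circle_piD.
      by have := vxy (index f s); rewrite index_mem /v nth_index //; exact.
    (* The sum lies above a point close to some [b] in [W]; lifting [b] to [S] and the difference to
       [V2] gives the element of [X] that approximates the sum. *)
    have [|b [Kb sb [v2 Vv2 v2E]]] := Kr0 _ Kpq.
      by move=> f fs; have [-> h] := lpq f fs; exists (x f + y f); rewrite ?(le_trans h).
    have [p1 p1E] := pr_surj b.
    have Sp1 : S (p1 - i (f0 p1)).
      by split; rewrite /= ?prB ?pr_i ?subr0 ?p1E // (morphDB f0D) f0i subrr.
    have prz : pr (v2 + (p1 - i (f0 p1))) = pr p + pr q.
      by rewrite prD prB pr_i subr0 p1E v2E subrK.
    have [t tE] : exists t, p + q - (v2 + (p1 - i (f0 p1))) = i t.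
      by apply: pr_ker; rewrite prB prz prD subrr.
    have Sz : V2S' (v2 + (p1 - i (f0 p1))) by exists v2, (p1 - i (f0 p1)).
    exists (v2 + (p1 - i (f0 p1)), x + y), t; split.
    + by split=> //=; rewrite ?prz // /lift /= prz.
    + exact: V2S'3 Sp Sq (V2S'N _ Sz) tE.
    + by apply: injective_projections => /=; [rewrite -tE subrKC|rewrite addr0].
  - move=> [p x] [q y] a [/= Sp _ _] [/= Sq _ _] [pq _].
    have S'0 : V2S' 0 by exists 0, 0; rewrite addr0.
    by apply: V2S'3 Sp (V2S'N _ Sq) S'0 _; rewrite addr0 pq addrAC subrr add0r.
have [|f [rho [rho_gt0 fD fj fX]]] := quasi_section_local_hom jD vD vj _ r_gt0 qX.
  by rewrite e3.
(* Two choices of angles for one [p] differ by an integer vector, on which [f] need not vanish. The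
   linear map [c] agrees with [f] on the basis vectors [d g] for [g] in [s]; after subtracting it,
   the choice of angles is irrelevant. *)
pose d (g : dual R A) : dual R A -> R := fun h => (h == g)%:R.
pose th (g : dual R A) : R := repr (f (0, d g)).
pose c (x : dual R A -> R) : circle R := circle_pi (\sum_(g <- s) th g * x g).
have cD : {morph c : x y / x + y}.
  move=> x y; rewrite /c -circle_piD -big_split; congr circle_pi.
  by apply: eq_bigr => g _ /=; rewrite -mulrDr.
pose g q := f q - c q.2.
have gD : {morph g : x y / x + y}.
  by move=> x y; rewrite /g fD cD opprD addrACA.
have g_int (m : dual R A -> R) : (forall h, m h \is a Num.int) ->
    (forall h, h \notin s -> m h = 0) -> g (0, m) = 0.
  move=> mi ms; have /choice[z zE] : forall h, exists z : int, m h = z%:~R.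
    by move=> h; have /intrP := mi h.
  pose F (x : dual R A -> R) := g (0, x).
  have FD : {morph F : x y / x + y}.
    by move=> x y; rewrite /F -gD; congr g; apply: injective_projections; rewrite /= ?addr0.
  have -> : m = \sum_(h <- s) d h *~ z h.
    apply/funext => h; pose ev (x : dual R A -> R) := x h.
    have evD : {morph ev : x y / x + y} by [].
    rewrite -[RHS]/(ev _) (morphD_sum evD).
    under eq_bigr do rewrite (morphDMz evD) /ev /d.
    have [hs|hs] := boolP (h \in s); last first.
      rewrite ms // big_seq big1 // => l ls; case: eqVneq => [hk|]; last by rewrite mul0rz.
      by rewrite -hk (negbTE hs) in ls.
    rewrite (bigD1_seq h) //= eqxx big1 ?addr0 // => l lh.
    by rewrite eq_sym (negbTE lh) mul0rz.
  rewrite -[LHS]/(F _) (morphD_sum FD) big_seq big1 // => h hs.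
  rewrite (morphDMz FD) /F /g /c /= (bigD1_seq h) //= big1 => [|l lh].
    by rewrite /d eqxx mulr1 addr0 /th circle_piK subrr mul0rz.
  by rewrite /d (negbTE lh) mulr0.
have g_lift p x y : (forall h : dual R A, h \in s -> circle_pi (x h) = h (pr p)) ->
    (forall h, h \notin s -> x h = 0) ->
    (forall h : dual R A, h \in s -> circle_pi (y h) = h (pr p)) ->
    (forall h, h \notin s -> y h = 0) -> g (p, x) = g (p, y).
  move=> xs xns ys yns; have -> : (p, x) = (p, y) + (0, x - y) :> Q.
    by apply: injective_projections; rewrite /= ?addr0 // subrKC.
  rewrite gD g_int ?addr0 // => h; rewrite -[(x - y) h]/(x h - y h); last first.
    by move=> hs; rewrite xns // yns // subrr.
  have [hs|hs] := boolP (h \in s); last by rewrite xns // yns // subrr rpred0.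
  by apply/circle_piP; rewrite xs // ys.
pose x p (h : dual R A) : R := if h \in s then repr (h (pr p)) else 0.
have xs p (h : dual R A) : h \in s -> circle_pi (x p h) = h (pr p).
  by move=> hs; rewrite /x hs circle_piK.
have xns p h : h \notin s -> x p h = 0 by move=> /negbTE hs; rewrite /x hs.
(* The angles [x p] are chosen without continuity. Additivity and continuity of [psi] come from
   [g_lift], which allows other angles for each purpose. *)
pose psi p := g (p, x p).
have psiD : {morph psi : p q / p + q}.
  move=> p q; rewrite /psi -gD; apply: g_lift => h hs; rewrite ?xs ?xns //.
    by rewrite circle_piD !xs // prD (chomD h).
  by rewrite -[LHS]/(x p h + x q h) !xns // addr0.
have psi_i a : psi (i a) = a.
  have -> : psi (i a) = g (i a, 0).
    apply: g_lift => // h hs; [exact: xs|exact: xns|].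
    by rewrite pr_i circle_pi0 (morphD0 (chomD h)).
  by rewrite /g fj (morphD0 cD) subr0.
pose B : R := 1 + \sum_(h <- s) `|th h|.
have B_gt0 : 0 < B by rewrite ltr_pwDl // sumr_ge0.
(* With angles at most [rho1], [f] contributes [3 * 64^-1] and [c] at most [64^-1], in total
   [16^-1 < 4^-1]. *)
pose rho1 := Num.min rho (Num.min r (64^-1 / B)).
have [rho1_gt0 rho1_rho rho1_r rho1_B] :
    [/\ 0 < rho1, rho1 <= rho, rho1 <= r & rho1 * B <= 64^-1].
  split; rewrite /rho1 ?ge_min ?lexx ?orbT //.
    by rewrite !lt_min rho_gt0 r_gt0 divr_gt0 // invr_gt0.
  by rewrite -ler_pdivlMr // !ge_min lexx !orbT.
have psi_small : nbhs 0 (small 16^-1 \o psi).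
  have ns (u : seq (dual R A)) : \forall p \near 0, forall h : dual R A, h \in u -> small rho1 (h (pr p)).
    elim: u => [|h u IH]; first exact: nearW.
    have nh : \forall p \near 0, small rho1 (h (pr p)).
      have hc : continuous (fun p => h (pr p)).
        by move=> p; apply: continuous_comp; [exact: pr_cts|exact: chom_continuous].
      apply: (hc 0); rewrite pr0 (morphD0 (chomD h)); exact: small_nbhs.
    apply: filterS2 nh IH => p hp up l; rewrite inE => /orP[/eqP -> //|]; exact: up.
  have nKp : nbhs 0 [set p | K (pr p)].
    by have nK' : nbhs (pr 0) K by [rewrite pr0]; exact: (@pr_cts 0 _ nK').
  apply: filterS3 nV2 nKp (ns s) => p Vp Kp sp /=.
  have /choice[y yP] : forall h : dual R A, exists t : R,
      (h \in s -> h (pr p) = circle_pi t /\ `|t| <= rho1) /\ (h \notin s -> t = 0).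
    move=> h; have [hs|hs] := boolP (h \in s); last by exists 0.
    by have [t te tE] := sp h hs; exists t.
  have ys (h : dual R A) hs := (yP h).1 hs.
  have -> : psi p = g (p, y).
    apply: g_lift => h hs; [exact: xs|exact: xns| |exact: (yP h).2].
    by have [-> _] := ys h hs.
  have fy : small (3 * 64^-1) (f (p, y)).
    rewrite -e3 mulrCA; apply: fX => [|l ln]; last first.
      by have [|_ h] := ys (nth 0 s l) _; [exact: mem_nth|exact: le_trans h rho1_rho].
    split=> //=; first by exists p, 0; rewrite addr0.
    by move=> h /ys[hE h1]; split=> //; exact: le_trans h1 rho1_r.
  have cy : small 64^-1 (c y).
    apply: small_le (small_pi _); apply: le_trans rho1_B.
    apply: le_trans (ler_norm_sum _ _ _) _; rewrite /B mulrDr mulr1 mulr_sumr.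
    apply: (@le_trans _ _ (\sum_(h <- s) rho1 * `|th h|)).
      rewrite big_seq [leRHS]big_seq; apply: ler_sum => h hs.
      by rewrite normrM mulrC ler_wpM2r //; have [_] := ys h hs.
    by rewrite lerDr ltW.
  exact: small_le le16 (smallB fy cy).
have psi_cts : continuous psi by exact: small_continuous psiD lt16 psi_small.
by exists (Chom psiD psi_cts).
Qed.

End Splitting.

(** * Mumford groups with circle center *)

Lemma comp_continuous (X Y Z : topologicalType) (f : X -> Y) (g : Y -> Z) :
  continuous f -> continuous g -> continuous (fun x => g (f x)).
Proof. by move=> fc gc x; apply: continuous_comp; [exact: fc|exact: gc]. Qed.

(** * Functoriality of [chom] and transfer of topological properties *)

Section ChomFunctoriality.
Context (X X' Y Y' : topologicalZmodType).

Lemma chom_comp_continuous_l (g : chom Y Y') :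
  continuous (fun f : chom X Y => chom_comp g f).
Proof.
apply: continuous_to_chom => f C O cC oO fCO.
have : nbhs f [set h : chom X Y | h @` C `<=` g @^-1` O].
  apply: chom_nbhs => //; first by apply: open_comp => // y _; exact: chom_continuous.
  by move=> _ [x Cx <-]; apply: fCO; exists x.
by apply: filterS => h hC _ [x Cx <-]; apply: hC; exists x.
Qed.

Lemma chom_comp_continuous_r (f : chom X X') :
  continuous (fun g : chom X' Y => chom_comp g f).
Proof.
apply: continuous_to_chom => g C O cC oO gCO.
have : nbhs g [set h : chom X' Y | h @` (f @` C) `<=` O].
  apply: chom_nbhs => //.
    by apply: continuous_compact => //; apply: continuous_subspaceT; exact: chom_continuous.
  by move=> _ [_ [x Cx <-] <-]; apply: gCO; exists x.
by apply: filterS => h hC _ [x Cx <-]; apply: hC; exists (f x) => //; exists x.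
Qed.

End ChomFunctoriality.

Lemma chom_comp_iso (X Y Y' : topologicalZmodType) (g : chom Y Y') : zmod_isomorphism g ->
  zmod_isomorphism (fun f : chom X Y => chom_comp g f).
Proof.
move=> [gD [g' [gK g'K _ g'c]]].
have g'D : {morph g' : x y / x + y}.
  by move=> x y; apply: (can_inj gK); rewrite gD !g'K.
split; first by move=> f h; apply: chomP => x; rewrite chom_addE -[LHS]/(g ((f + h : chom X Y) x)) chom_addE chomD.
exists (fun f => chom_comp (Chom g'D g'c) f); split.
- by move=> f; apply: chomP => x; exact: gK.
- by move=> f; apply: chomP => x; exact: g'K.
- exact: chom_comp_continuous_l.
- exact: chom_comp_continuous_l.
Qed.

Lemma zmod_isomorphism_comp (A B C : topologicalZmodType) (f : A -> B) (g : B -> C) :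
  zmod_isomorphism f -> zmod_isomorphism g -> zmod_isomorphism (g \o f).
Proof.
move=> [fD [f' [fK f'K fc f'c]]] [gD [g' [gK g'K gc g'c]]].
split; first by move=> x y /=; rewrite fD gD.
exists (f' \o g'); split; [exact: can_comp|exact: can_comp|..].
- by move=> x; apply: continuous_comp; [exact: fc|exact: gc].
- by move=> x; apply: continuous_comp; [exact: g'c|exact: f'c].
Qed.

Lemma locally_compact_open_image (X Y : topologicalType) (f : X -> Y) :
  locally_compact [set: X] -> hausdorff_space Y -> continuous f ->
  (forall U, open U -> open (f @` U)) -> (forall y, exists x, f x = y) ->
  locally_compact [set: Y].
Proof.
move=> lcX hY fc fo fs y _; have [x <-] := fs y.
have [//|C] := lcX x; rewrite withinET => nC [cC _].
have cfC : compact (f @` C) by apply: continuous_compact => //; exact: continuous_subspaceT.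
exists (f @` C); last by split=> //; exact: compact_closed.
rewrite withinET; apply: (@filterS _ _ _ (f @` C°)).
  by apply: image_subset; exact: interior_subset.
by apply: open_nbhs_nbhs; split; [exact/fo/open_interior|exists x].
Qed.

(** The image of [U] is the union, over [x] in the kernel of [f], of the preimages of [U] under
    [y |-> x + s y]. *)
Lemma split_epi_open (X Y : topologicalZmodType) (f : X -> Y) (s : Y -> X) (U : set X) :
  {morph f : x y / x + y} -> continuous s -> cancel s f -> open U -> open (f @` U).
Proof.
move=> fD sc sK oU.
rewrite (_ : _ @` _ = \bigcup_(x in [set x | f x = 0]) ((fun y => x + s y) @^-1` U)).
  apply: bigcup_open => x _; apply: open_comp => // y _; move: y.
  by apply: (comp_continuous (continuous_pair _ sc) (@add_continuous X)) => y; exact: cvg_cst.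
apply/seteqP; split=> [_ [x Ux <-]|y [x /= fx Uxy]]; last first.
  by exists (x + s y); rewrite // fD fx add0r sK.
by exists (x - s (f x)); rewrite /= ?subrK // (morphDB fD) sK subrr.
Qed.

Lemma injective_hausdorff (X Y : topologicalType) (f : X -> Y) :
  hausdorff_space Y -> continuous f -> injective f -> hausdorff_space X.
Proof.
move=> hY fc fi x y xy; apply: fi; apply: hY => U V nU nV.
by have [z [/= Uz Vz]] := xy _ _ (fc _ _ nU) (fc _ _ nV); exists (f z).
Qed.

Lemma dual_hausdorff (R : realType) (X : topologicalZmodType) : hausdorff_space (dual R X).
Proof.
move=> f g fg; apply: chomP => x; apply: (circle_hausdorff (R := R)) => U V nU nV.
have [h [/= Uh Vh]] := fg _ _ (@chom_eval_continuous _ _ x f _ nU) (@chom_eval_continuous _ _ x g _ nV).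
by exists ((h : dual R X) x).
Qed.

(** * Commutative subgroups as additive topological groups *)

Record abelian_subgroup (G : topologicalGroupType) := AbelianSubgroup {
  subgroup_set : set G ;
  subgroup1 : subgroup_set 1%g ;
  subgroupM : forall x y, subgroup_set x -> subgroup_set y -> subgroup_set (x * y)%g ;
  subgroupV : forall x, subgroup_set x -> subgroup_set (x^-1)%g ;
  subgroup_commute : forall x y, subgroup_set x -> subgroup_set y -> commute x y
}.

Section AdditiveSubgroup.
Context (G : topologicalGroupType) (H : abelian_subgroup G).

Definition additive_subgroup : Type := subgroup_set H.

HB.instance Definition _ := Topological.copy additive_subgroup (subgroup_set H : Type).

Definition subgroup_elt (x : G) (Hx : subgroup_set H x) : additive_subgroup :=
  exist _ x (mem_set Hx).

Definition subgroup_val (x : additive_subgroup) : G := val x.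

Lemma subgroup_valP x : subgroup_set H (subgroup_val x).
Proof. exact: set_mem (valP x). Qed.

Lemma subgroup_val_inj : injective subgroup_val.
Proof. exact: val_inj. Qed.

Lemma subgroup_val_continuous : continuous subgroup_val.
Proof. exact: initial_continuous. Qed.

Let zero := subgroup_elt (subgroup1 H).
Let opp x := subgroup_elt (subgroupV (subgroup_valP x)).
Let add x y := subgroup_elt (subgroupM (subgroup_valP x) (subgroup_valP y)).
Let addA : associative add.
Proof. by move=> x y z; apply: subgroup_val_inj; exact: mulgA. Qed.
Let addC : commutative add.
Proof. by move=> x y; apply: subgroup_val_inj; exact: (subgroup_commute (subgroup_valP x) (subgroup_valP y)). Qed.
Let add0 : left_id zero add.
Proof. by move=> x; apply: subgroup_val_inj; exact: mul1g. Qed.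
Let addN : left_inverse zero opp add.
Proof. by move=> x; apply: subgroup_val_inj; exact: mulVg. Qed.

HB.instance Definition _ :=
  GRing.isZmodule.Build additive_subgroup addA addC add0 addN.

Let sub_cts : continuous (fun p : additive_subgroup * additive_subgroup => p.1 - p.2).
Proof.
apply: continuous_comp_initial => p.
apply: (@continuous_comp _ (G * G)%type _
  (fun p => (subgroup_val p.1, (subgroup_val p.2)^-1%g)) (fun q : G * G => (q.1 * q.2)%g));
  last exact: mulg_continuous.
move: p; apply: continuous_pair.
  by apply: comp_continuous subgroup_val_continuous => p; exact: cvg_fst.
apply: comp_continuous (@invg_continuous G).
by apply: comp_continuous subgroup_val_continuous => p; exact: cvg_snd.
Qed.

HB.instance Definition _ := PreTopologicalNmodule_isTopologicalZmodule.Build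
  additive_subgroup sub_cts.

Lemma subgroup_valD x y : subgroup_val (x + y) = (subgroup_val x * subgroup_val y)%g.
Proof. by []. Qed.

End AdditiveSubgroup.

(** * Lifting isotropic subgroups of [K] to [G] *)

Section CenterCircle.
Context (R : realType) (G : topologicalGroupType) (hG : nilpotent2 G).
Notation Z := (additive_group (center_abelian G)).
Notation K := (additive_group hG).
Context (zeta : chom Z (circle R)) (zeta_iso : zmod_isomorphism zeta).
Notation nabla := (mumford_dual hG zeta).

Lemma mumford_dualE (x y : G) :
  nabla (center_pi x) (center_pi y) = zeta (comm hG x y).
Proof.
rewrite -[LHS]/(zeta (mumford hG (center_pi x) (center_pi y))).
by congr (zeta _); apply: (@center_val_inj G); rewrite mumfordE.
Qed.

Lemma mumford_dual_eq0 (x y : G) :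
  nabla (center_pi x) (center_pi y) = 0 -> commute x y.
Proof.
have [zD [z' [zK _ _ _]]] := zeta_iso.
rewrite mumford_dualE -(morphD0 zD) => /(can_inj zK) /(congr1 (@center_val G)).
by move=> /eqP/commgP.
Qed.

(* Over an isotropic subgroup [A] of [K], the group [G] restricts to an abelian
   extension of [A] by the circle, which splits. *)
Lemma isotropic_lift (A : topologicalZmodType) (alpha : A -> K) (beta : K -> A) :
  {morph alpha : a b / a + b} -> continuous alpha ->
  {morph beta : a b / a + b} -> continuous beta -> cancel alpha beta ->
  (forall a b, nabla (alpha a) (alpha b) = 0) ->
  locally_compact [set: A] ->
  (forall a : A, a <> 0 -> exists f : dual R A, f a <> 0) ->
  exists s : A -> G, [/\ continuous s, forall a b, s (a + b) = (s a * s b)%g &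
    forall a, center_pi (s a) = alpha a].
Proof.
move=> aD ac bD bc aK iso lcA sepA.
(* The preimage in [G] of the image of [alpha], described as the fixed points of the idempotent
   [alpha \o beta]. *)
pose H := [set g : G | alpha (beta (center_pi g)) = center_pi g].
have H1 : H 1%g by rewrite /H /= -[center_pi 1%g]/(0 : K) (morphD0 bD) (morphD0 aD).
have HM x y : H x -> H y -> H (x * y)%g.
  by rewrite /H /= (quotient_piD hG) bD aD => -> ->.
have HV x : H x -> H (x^-1)%g.
  by rewrite /H /= center_piV -[(center_pi x)^-1%g]/(- (center_pi x : K)) (morphDN bD) (morphDN aD) => ->.
(* The Mumford map computes commutators, so isotropy makes this preimage commutative. *)
have HC x y : H x -> H y -> commute x y.
  by move=> Hx Hy; apply: mumford_dual_eq0; rewrite -Hx -Hy iso.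
pose S := AbelianSubgroup H1 HM HV HC.
pose P : topologicalZmodType := additive_subgroup S.
pose pr (p : P) : A := beta (center_pi (subgroup_val p)).
have [zD [z' [zK z'K zc z'c]]] := zeta_iso.
have z'D : {morph z' : a b / a + b} by move=> a b; apply: (can_inj zK); rewrite zD !z'K.
have Hz t : H (center_val (z' t)).
  have e : center_pi (center_val (z' t)) = center_pi 1%g.
    apply/esym/center_piP; rewrite invg1 mul1g; exact: center_valP.
  by rewrite /H /= e; exact: H1.
pose i t : P := @subgroup_elt G S (center_val (z' t)) (Hz t).
have iD : {morph i : a b / a + b}.
  by move=> a b; apply: (@subgroup_val_inj G S); rewrite subgroup_valD /subgroup_val /= z'D.
have prD : {morph pr : a b / a + b}.
  by move=> a b; rewrite /pr subgroup_valD (quotient_piD hG) bD.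
have prc : continuous pr.
  apply: comp_continuous bc; apply: comp_continuous (@center_pi_continuous G).
  exact: subgroup_val_continuous.
have elt g : H g -> exists2 p : P, subgroup_val p = g & pr p = beta (center_pi g).
  by move=> Hg; exists (@subgroup_elt G S g Hg).
have lift a : exists p : P, pr p = a.
  have [|p _ pE] := elt (repr (alpha a : center_quotient G)).
    by rewrite /H /= center_piK aK.
  by exists p; rewrite pE center_piK aK.
have pr_open (U : set P) : open U -> open (pr @` U).
  move=> [O oO <-]; rewrite (_ : _ @` _ = alpha @^-1` (@center_pi G @` O)).
    apply: open_comp; last exact: center_pi_open.
    by move=> a _; exact: ac.
  apply/seteqP; split=> [_ [p Op <-]|a [g Og ga]].
    by exists (subgroup_val p) => //; rewrite /pr; exact/esym/(subgroup_valP p).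
  have [|p pg pE] := elt g; first by rewrite /H /= ga aK.
  exists p; first by rewrite -[_ p]/(O (subgroup_val p)) pg.
  by rewrite pE ga aK.
have pr_i t : pr (i t) = 0.
  rewrite /pr -[subgroup_val _]/(center_val (z' t)).
  have -> : center_pi (center_val (z' t)) = center_pi 1%g.
    by apply/esym/center_piP; rewrite invg1 mul1g; exact: center_valP.
  exact: (morphD0 bD).
have pr_ker p : pr p = 0 -> exists t, p = i t.
  move=> p0; have cp : Defs.center G (subgroup_val p).
    have := subgroup_valP p; rewrite -[X in X -> _]/(alpha (pr p) = center_pi (subgroup_val p)).
    by rewrite p0 (morphD0 aD) => /center_piP; rewrite invg1 mul1g.
  exists (zeta (center_elt cp)); apply: (@subgroup_val_inj G S).
  by rewrite -[RHS]/(center_val (z' _)) zK.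
have i_emb e : 0 < e -> nbhs 0 [set p | forall t, p = i t -> small e t].
  move=> e0; have : nbhs (0 : Z) [set z | small e (zeta z)].
    have := small_nbhs e0; rewrite -(morphD0 zD); exact: zc.
  move=> [_ [[O oO <-] O1] OE].
  exists ((@subgroup_val G S) @^-1` O); split; first by exists O.
    exact: O1.
  by move=> p /= Ot t tE; rewrite -[t]z'K; apply: OE; move: Ot; rewrite tE.
have [f fi] := @circle_extension_splits R P A i pr iD prD pr_open prc lift pr_i pr_ker i_emb lcA sepA.
(* [h] removes the circle component and hence depends on [pr p] only. Composed with any choice of
   preimages it is a section, continuous because [pr] is open. *)
pose h (p : P) : P := p - i (f p).
have hD : {morph h : p q / p + q} by move=> p q; rewrite /h chomD iD opprD addrACA.
have ic : continuous i.
  apply: continuous_comp_initial.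
  have := comp_continuous z'c (@center_val_continuous G); exact.
have hc : continuous h.
  have pc : continuous (fun p : P => (p, i (f p))).
    apply: continuous_pair => [p|]; first exact: cvg_id.
    exact: (comp_continuous (@chom_continuous _ _ f) ic).
  exact: (comp_continuous pc (@sub_continuous P)).
have h_eq p q : pr p = pr q -> h p = h q.
  move=> pq; have [|t tE] := pr_ker (p - q); first by rewrite (morphDB prD) pq subrr.
  rewrite -(subrK q p) hD tE [h (i t)]/h fi subrr add0r //.
have pr_h p : pr (h p) = pr p by rewrite /h (morphDB prD) pr_i subr0.
have /choice[l lP] := lift.
exists (fun a => subgroup_val (h (l a))); split.
- apply/continuousP => O oO.
  have hO : open ((fun p => subgroup_val (h p)) @^-1` O).
    apply: open_comp => // p _; move: p.
    exact: (comp_continuous hc (@subgroup_val_continuous G S)).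
  rewrite (_ : _ @^-1` O = pr @` ((fun p => subgroup_val (h p)) @^-1` O)); first exact: pr_open.
  apply/seteqP; split=> [a Oa|_ [p Op <-]] /=; first by exists (l a).
  by rewrite (h_eq (l (pr p)) p).
- by move=> a b; rewrite -subgroup_valD -hD; congr subgroup_val; apply: h_eq; rewrite prD !lP.
- move=> a; rewrite -(subgroup_valP (h (l a))) -[beta _]/(pr (h (l a))) pr_h lP //.
Qed.

End CenterCircle.

Lemma pair_continuous_l (X Y : topologicalType) (y : Y) : continuous (fun x : X => (x, y)).
Proof. by move=> x; apply: cvg_pair; [exact: cvg_id|exact: cvg_cst]. Qed.

Lemma pair_continuous_r (X Y : topologicalType) (x : X) : continuous (fun y : Y => (x, y)).
Proof. by move=> y; apply: cvg_pair; [exact: cvg_cst|exact: cvg_id]. Qed.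

(** * From a standard self-duality to a Mackey-Weil group *)

Section StandardToMackeyWeil.
Context (R : realType) (G : topologicalGroupType) (hG : nilpotent2 G).
Notation Z := (additive_group (center_abelian G)).
Notation K := (additive_group hG).
Context (zeta : chom Z (circle R)) (zeta_iso : zmod_isomorphism zeta).
Notation nabla := (mumford_dual hG zeta).

Lemma standard_mackey_weil : standard_self_duality nabla ->
  exists (E : topologicalZmodType) (hE : locally_compact_hausdorff E),
    isomorphic_groups G (mackey_weil R hE).
Proof.
move=> [[[_ lcK] [nD [n' [nK _ _ _]]] _] [A hA [phi [[phiD [phi' [phiK phi'K phic phi'c]]] phiE]]]].
exists A, hA.
have [zD [z' [zK z'K zc z'c]]] := zeta_iso.
have z'D : {morph z' : a b / a + b} by move=> a b; apply: (can_inj zK); rewrite zD !z'K.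
have phi'D : {morph phi' : a b / a + b} by move=> a b; apply: (can_inj phiK); rewrite phiD !phi'K.
pose D : topologicalZmodType := dual R A.
pose a1 (a : A) : K := phi' (a, 0); pose a2 (f : D) : K := phi' (0, f).
pose b1 (k : K) : A := (phi k).1; pose b2 (k : K) : D := (phi k).2.
have nablaE k l : nabla k l = (b2 l : dual R A) (b1 k) - (b2 k : dual R A) (b1 l).
  by rewrite -phiE.
have [b1a1 b2a1] : (forall a, b1 (a1 a) = a) /\ (forall a, b2 (a1 a) = 0).
  by rewrite /b1 /b2 /a1; split=> a; rewrite phi'K.
have [b1a2 b2a2] : (forall f, b1 (a2 f) = 0) /\ (forall f, b2 (a2 f) = f).
  by rewrite /b1 /b2 /a2; split=> f; rewrite phi'K.
have a1D : {morph a1 : a b / a + b}.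
  move=> a b; rewrite /a1 -phi'D; congr phi'.
  by apply: injective_projections; rewrite /= ?addr0.
have a2D : {morph a2 : a b / a + b}.
  move=> a b; rewrite /a2 -phi'D; congr phi'.
  by apply: injective_projections; rewrite /= ?addr0.
have a1c : continuous a1 := comp_continuous (@pair_continuous_l A D 0) phi'c.
have a2c : continuous a2 := comp_continuous (@pair_continuous_r A D 0) phi'c.
have b1D : {morph b1 : a b / a + b} by move=> k l; rewrite /b1 phiD.
have b2D : {morph b2 : a b / a + b} by move=> k l; rewrite /b2 phiD.
have c1 : continuous (fun u : zprod A D => u.1) by move=> u; exact: cvg_fst.
have c2 : continuous (fun u : zprod A D => u.2) by move=> u; exact: cvg_snd.
have b1c : continuous b1 := comp_continuous phic c1.
have b2c : continuous b2 := comp_continuous phic c2.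
have lcD : locally_compact [set: D].
  apply: (locally_compact_open_image lcK _ b2c); first exact: dual_hausdorff.
    by move=> U; exact: split_epi_open b2D a2c b2a2.
  by move=> f; exists (a2 f).
(* If all characters kill [a], then [nabla (a1 a) = 0], and the injectivity of [nabla] gives
   [a = 0]. *)
have sepA (a : A) : a <> 0 -> exists f : dual R A, f a <> 0.
  move=> a0; apply: contra_notP a0 => na.
  rewrite -(b1a1 a) -(morphD0 b1D); congr b1; apply: (can_inj nK).
  rewrite (morphD0 nD); apply: chomP => l; rewrite nablaE b1a1 b2a1 !chom_zeroE subr0.
  by apply: contrapT => la; apply: na; exists (b2 l).
(* On the dual, evaluations at points of [A] are enough. *)
have sepD (f : D) : f <> 0 -> exists F : dual R D, F f <> 0.
  move=> f0; have [x fx] : exists x, (f : dual R A) x <> 0.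
    apply: contra_notP f0 => nx; apply: chomP => x.
    by apply: contrapT => fx; apply: nx; exists x.
  have evD : {morph (fun g : D => (g : dual R A) x) : g h / g + h} by move=> g h; exact: chom_addE.
  by exists (Chom evD (@chom_eval_continuous _ _ x)).
have iso1 a b : nabla (a1 a) (a1 b) = 0 by rewrite nablaE !b2a1 !chom_zeroE subrr.
have iso2 f g : nabla (a2 f) (a2 g) = 0.
  by rewrite nablaE !b1a2 (morphD0 (chomD _)) (morphD0 (chomD _)) subrr.
have [s1 [s1c s1D s1E]] := isotropic_lift zeta_iso a1D a1c b1D b1c b1a1 iso1 hA.2 sepA.
have [s2 [s2c s2D s2E]] := isotropic_lift zeta_iso a2D a2c b2D b2c b2a2 iso2 lcD sepD.
pose i t : G := center_val (z' t).
have iC t g : commute (i t) g := center_valP (z' t) g.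
have iD t t' : i (t + t') = (i t * i t')%g by rewrite /i z'D.
have comm12 a (f : D) : (s1 a * s2 f = s2 f * s1 a * i ((f : dual R A) a))%g.
  rewrite commgC; congr (_ * _)%g.
  have <- : zeta (comm hG (s1 a) (s2 f)) = (f : dual R A) a.
    by rewrite -mumford_dualE s1E s2E nablaE b1a1 b2a2 b2a1 !chom_zeroE subr0.
  by rewrite /i zK.
pose H := mackey_weil R hA.
(* With [s2] to the left of [s1], multiplying two such products moves [s1 x] past [s2 f'], which by
   [comm12] produces exactly the Heisenberg term [f' x]. *)
pose Psi (u : H) : G := (s2 u.1.2 * s1 u.1.1 * i u.2)%g.
have PsiM : {morph Psi : u v / (u * v)%g}.
  move=> [[x f] z] [[x' f'] t]; rewrite /Psi /= s1D s2D !iD.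
  rewrite -!mulgA; congr (_ * _)%g.
  have iCA u g h : (i u * (g * h) = g * (i u * h))%g by rewrite !mulgA iC.
  rewrite ![in RHS]iCA [RHS]mulgA comm12 -!mulgA [in RHS]iCA; do 3 congr (_ * _)%g.
  by rewrite [RHS]iC -mulgA.
have cP (g : G) : Defs.center G ((s2 (b2 (center_pi g)) * s1 (b1 (center_pi g)))^-1 * g)%g.
  apply/center_piP; rewrite (quotient_piD hG) s1E s2E /a1 /a2 -phi'D.
  rewrite -[RHS](phiK (center_pi g : K)); congr phi'.
  by apply: injective_projections; rewrite /= ?addr0 ?add0r.
pose cg (g : G) : center_group G := center_elt (cP g).
pose Phi (g : G) : H := (b1 (center_pi g), b2 (center_pi g), zeta (cg g)).
have PhiK : cancel Phi Psi.
  by move=> g; rewrite /Psi /Phi /i /= zK /cg /center_val /= mulVKg.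
have PsiK : cancel Psi Phi.
  move=> [[x f] z].
  have piE : center_pi (Psi (x, f, z)) = phi' (x, f) :> K.
    have pi_i : center_pi (i z) = 0 :> K.
      have -> : center_pi (i z) = center_pi 1%g.
        by apply/esym/center_piP; rewrite invg1 mul1g; exact: center_valP.
      by [].
    rewrite /Psi !(quotient_piD hG) s1E s2E pi_i addr0 /a1 /a2 -phi'D; congr phi'.
    by apply: injective_projections; rewrite /= ?addr0 ?add0r.
  have b1E : b1 (center_pi (Psi (x, f, z))) = x by rewrite piE /b1 phi'K.
  have b2E : b2 (center_pi (Psi (x, f, z))) = f by rewrite piE /b2 phi'K.
  rewrite /Phi b1E b2E; congr (_, _, _); rewrite -[RHS]z'K; congr (zeta _).
  apply: (@center_val_inj G); rewrite /cg /center_val /= b1E b2E.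
  by rewrite /Psi /= mulKg.
have mul_cts (X : topologicalType) (f g : X -> G) :
    continuous f -> continuous g -> continuous (fun x => f x * g x)%g.
  by move=> fc gc; exact: (comp_continuous (continuous_pair fc gc) (@mulg_continuous G)).
have pic := @center_pi_continuous G.
have cgc : continuous cg.
  apply: continuous_to_center; apply: (mul_cts); last by move=> g; exact: cvg_id.
  apply: comp_continuous (@invg_continuous G); apply: (mul_cts).
    exact: (comp_continuous (comp_continuous pic b2c) s2c).
  exact: (comp_continuous (comp_continuous pic b1c) s1c).
exists Phi; split; first by move=> g h; apply: (can_inj PsiK); rewrite PsiM !PhiK.
exists Psi; split=> //.
  apply: continuous_pair; last exact: (comp_continuous cgc zc).
  by apply: continuous_pair; [exact: (comp_continuous pic b1c)|exact: (comp_continuous pic b2c)].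
have h1 : continuous (fun u : H => u.1.1).
  by move=> u; apply: continuous_comp; exact: cvg_fst.
have h2 : continuous (fun u : H => u.1.2).
  by move=> u; apply: continuous_comp; [exact: cvg_fst|exact: cvg_snd].
have h3 : continuous (fun u : H => u.2) by move=> u; exact: cvg_snd.
have ic : continuous i := comp_continuous z'c (@center_val_continuous G).
apply: (mul_cts); last exact: (comp_continuous h3 ic).
by apply: (mul_cts); [exact: (comp_continuous h2 s2c)|exact: (comp_continuous h1 s1c)].
Qed.

End StandardToMackeyWeil.

(* On small dyadic angles [j] is the multiplication by some [c], which is not
   [0] if [j] is injective; dyadic angles are dense. *)
Lemma circle_endo_surjective (R : realType) (j : circle R -> circle R) :
  {morph j : a b / a + b} -> continuous j -> injective j -> forall a, exists b, j b = a.
Proof.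
move=> jD jc j_inj.
have small_j e : 0 < e -> exists2 d, 0 < d & forall s : R, `|s| <= d -> small e (j (circle_pi s)).
  move=> e0; have : nbhs (j (circle_pi 0)) (small e).
    by rewrite circle_pi0 (morphD0 jD); exact: small_nbhs.
  move=> /(@comp_continuous _ _ _ _ _ (@circle_pi_continuous R) jc 0).
  move=> /nbhs_ballP[d /= d0 dE]; exists (d / 2); first by rewrite divr_gt0.
  by move=> s sd; apply: dE; rewrite -ball_normE /= sub0r normrN; lra.
have p2 k : 0 < 2 ^+ k :> R by rewrite exprn_gt0.
have [d0 d0_gt0 jd0] := small_j 8^-1 (ltac:(lra)).
have [k0 k0P] := half_pow_lt (@ler01 R) d0_gt0.
(* The exponent [k0] keeps the angles below [d0]; the extra [1] ensures [q 0 < 1], so that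
   [circle_pi (q 0)] is not [0]. *)
pose q k : R := 1 / 2 ^+ (k0.+1 + k).
have q_gt0 k : 0 < q k by rewrite divr_gt0.
have q2 k : q k = q k.+1 + q k.+1.
  by rewrite /q addnS [in RHS]exprS; field; rewrite ?expf_neq0 ?pnatr_eq0.
have qd k : q k <= d0.
  apply: le_trans k0P; rewrite ler_pM2l // lef_pV2 ?posrE //.
  by apply: ler_weXn2l; rewrite ?ler1n // addSnnS leq_addr.
have jq k : small 8^-1 (j (circle_pi (q k))) by apply: jd0; rewrite (ger0_norm (ltW (q_gt0 k))) qd.
have [x0 x08 x0E] := jq 0%N.
(* Both [x + x] and [x0 / 2 ^+ k] are angles of [j (circle_pi (q k))] of size at most [4^-1], hence
   equal: [j] follows each halving exactly. *)
have jqE k : j (circle_pi (q k)) = circle_pi (x0 / 2 ^+ k).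
  elim: k => [|k IH]; first by rewrite divr1.
  have [x x8 xE] := jq k.+1; rewrite xE; congr circle_pi.
  have : circle_pi (x + x) = circle_pi (x0 / 2 ^+ k) :> circle R.
    by rewrite -IH q2 circle_piD jD circle_piD -xE.
  move=> /circle_pi_inj xx; have {}xx : x + x = x0 / 2 ^+ k.
    apply: xx; have : `|x0 / 2 ^+ k| <= 8^-1.
      rewrite normrM normfV (ger0_norm (ltW (p2 k))) ler_pdivrMr //.
      apply: le_trans x08 _; rewrite ler_peMr ?invr_ge0 //.
      by apply: exprn_ege1; rewrite ler1n.
    by move: x8; rewrite !ler_norml ltr_norml => /andP[? ?] /andP[? ?]; lra.
  by rewrite exprS invfM mulrCA -xx; lra.
have x0_neq0 : x0 != 0.
  apply: contraTneq isT => x00; have : circle_pi (q 0%N) = 0 :> circle R.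
    by apply: j_inj; rewrite x0E x00 circle_pi0 (morphD0 jD).
  rewrite -circle_pi0 => /circle_pi_inj; have q1 : q 0%N < 1.
    rewrite /q addn0 ltr_pdivrMr // mul1r exprn_egt1 ?ltr1n //.
  by have := q_gt0 0%N; rewrite subr0 => q0 /(_ (ltac:(by rewrite ger0_norm ?ltW))); lra.
pose c := x0 / q 0%N.
have c_neq0 : c != 0 by rewrite mulf_neq0 // invr_neq0 // gt_eqF.
have jcE k : j (circle_pi (q k)) = circle_pi (c * q k).
  rewrite jqE; congr circle_pi; rewrite /c /q addn0 exprD; field.
  by rewrite ?expf_neq0 ?pnatr_eq0.
move=> a; pose t := repr a / c; exists (circle_pi t).
apply/eqP; rewrite -subr_eq0; apply/eqP/small_eq0 => e e_gt0.
have e2_gt0 : 0 < e / 2 by rewrite divr_gt0.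
have [d d_gt0 jd] := small_j _ e2_gt0.
have c_gt0 : 0 < `|c| by rewrite normr_gt0.
have [k kP] : exists k, 1 / 2 ^+ k <= Num.min d (e / 2 / `|c|).
  by apply: half_pow_lt; rewrite // lt_min d_gt0 divr_gt0.
have {kP}[kd ke] : q k <= d /\ q k <= e / 2 / `|c|.
  apply/andP; rewrite -le_min; apply: le_trans kP; rewrite ler_pM2l // lef_pV2 ?posrE //.
  by apply: ler_weXn2l; rewrite ?ler1n // leq_addl.
(* [s] is a multiple of [q k] within [q k] of [t], and [j] is multiplication by [c] there; the
   errors [j (circle_pi (t - s))] and [c * (s - t)] are each at most [e / 2]. *)
pose m := Num.floor (t / q k); pose s := q k *~ m.
have ts : `|t - s| <= q k.
  have tE : t = t / q k * q k by rewrite divfK // gt_eqF.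
  have [m1 m2] : m%:~R <= t / q k /\ t / q k <= (m + 1)%:~R.
    by split; [exact: floor_le|exact/ltW/floorD1_gt].
  rewrite /s -mulrzl {1}tE -mulrBl normrM (ger0_norm (ltW (q_gt0 k))).
  by rewrite ler_piMl ?(ltW (q_gt0 k)) // ler_norml; apply/andP; rewrite intrD in m2; split; lra.
have jsE : j (circle_pi s) = circle_pi (c * s).
  rewrite /s (morphDMz (@circle_piD R)) (morphDMz jD) jcE -(morphDMz (@circle_piD R)).
  by rewrite mulrzAr.
have -> : j (circle_pi t) - a = j (circle_pi (t - s)) + circle_pi (c * (s - t)).
  have aE : circle_pi (c * t) = a by rewrite /t mulrC divfK // circle_piK.
  rewrite circle_piD circle_piN jD (morphDN jD) jsE mulrBr circle_piD circle_piN aE.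
  by rewrite addrA subrK.
rewrite [e]splitr; apply: smallD; first by apply: jd; exact: le_trans ts kd.
apply: small_le (small_pi _); rewrite normrM distrC mulrC -ler_pdivlMr //.
exact: le_trans ts ke.
Qed.

(** * Commutators and center of a generalized Heisenberg group *)

Section HeisenbergCommutators.
Context (E F A : topologicalZmodType) (w : bilinear_form E F A).
Implicit Types (u v : heisenberg w).

Lemma heisenberg_commute u v : w u.1.1 v.1.2 = w v.1.1 u.1.2 -> commute u v.
Proof.
case: u v => [[x y] z] [[x' y'] z'] /= wE.
rewrite /commute -[LHS]/(_, _, _) -[RHS]/(_, _, _) /= wE.
by congr (_, _, _ + _); exact: addrC.
Qed.

Lemma heisenberg_commg u v :
  [~ u, v]%g = (0, 0, w u.1.1 v.1.2 - w v.1.1 u.1.2) :> heisenberg w.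
Proof.
apply: (@mulgI _ (v * u)%g); rewrite -commgC.
case: u v => [[x y] z] [[x' y'] z'] /=.
rewrite -[LHS]/(_, _, _) -[RHS]/(_, _, _) /= !addr0 (morphD0 (bformDr w _)) addr0.
congr (_, _, _); rewrite ?[x' + _]addrC ?[y' + _]addrC //.
by rewrite [z' + z]addrC -[RHS]addrA subrKC.
Qed.

(** Commuting with [(x', y', 0)] gives [w x y' = w x' y] for all [x'] and [y']; setting one of them
    to [0] makes both sides vanish, and separatedness concludes. *)
Lemma heisenberg_center u : Defs.separated w -> Defs.center (heisenberg w) u -> u.1 = (0, 0).
Proof.
case: u => [[x y] z] [w1 w2] cu /=.
have wE x' y' : w x y' = w x' y.
  have := cu (x', y', 0); rewrite /commute -[LHS]/(_, _, _) -[RHS]/(_, _, _) /= => -[_ _].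
  by rewrite addr0 add0r => /addrI.
have -> : x = 0.
  apply: contrapT => /w1[y']; apply.
  by rewrite (wE 0) (morphD0 (bformDl w _)).
have -> // : y = 0.
apply: contrapT => /w2[x']; apply.
by rewrite -(wE _ 0) (morphD0 (bformDr w _)).
Qed.

End HeisenbergCommutators.

(** * The self-duality of [K] and the implications between the three conditions *)

Section Equivalences.
Context (R : realType) (G : topologicalGroupType) (hG : nilpotent2 G).
Notation Z := (additive_group (center_abelian G)).
Notation K := (additive_group hG).
Context (zeta : chom Z (circle R)) (zeta_iso : zmod_isomorphism zeta).
Notation nabla := (mumford_dual hG zeta).

(** [K] is Hausdorff because [nabla] injects it continuously into a dual, and then locally compact
    as an open image of [G]; [nabla] is alternating because every element commutes with itself. *)
Lemma mumford_symplectic : locally_compact [set: G] -> mumford_group hG ->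
  symplectic_self_duality nabla.
Proof.
move=> lcG mG.
have nab_iso : zmod_isomorphism nabla.
  exact: (zmod_isomorphism_comp mG (chom_comp_iso K zeta_iso)).
have [nD [n' [nK _ nc _]]] := nab_iso.
have hK : hausdorff_space K := injective_hausdorff (@dual_hausdorff R K) nc (can_inj nK).
split=> //; last first.
  move=> k; rewrite -[k]center_piK mumford_dualE.
  rewrite -[RHS](morphD0 (chomD zeta)); congr (zeta _); apply: (@center_val_inj G).
  by apply/eqP/commgP.
split=> //; apply: (@locally_compact_open_image G K (@center_pi G)) => //.
- exact: center_pi_continuous.
- exact: center_pi_open.
- by move=> k; exists (repr (k : center_quotient G)); exact: center_piK.
Qed.

(** Through [kap], [K] is [E * F] and [nabla] is the alternating form built from [iota] and [w]. The
    map [wf] identifies [F] with the dual of [E], and turns this form into the standard one. *)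
Lemma heisenberg_standard : generalized_heisenberg G ->
  symplectic_self_duality nabla -> standard_self_duality nabla.
Proof.
move=> [E [F [A [w [sep [alpha [aM [beta [aK bK ac bc]]]]]]]]] symp.
have bM : {morph beta : u v / (u * v)%g} by move=> u v; apply: (can_inj aK); rewrite aM !bK.
have a1 : alpha 1%g = 1%g by apply: (mulgI (alpha 1%g)); rewrite -aM !mulg1.
have aV x : alpha x^-1%g = (alpha x)^-1%g by apply: (mulgI (alpha x)); rewrite -aM !mulgV.
have [[hK lcK] [nD [n' [nK n'K nc n'c]]] _] := symp; split=> //.
have aC x : Defs.center G x -> Defs.center (heisenberg w) (alpha x).
  by move=> cx u; rewrite -[u]bK /commute -!aM cx.
have bC u : Defs.center (heisenberg w) u -> Defs.center G (beta u).
  by move=> cu x; apply: (can_inj aK); rewrite !aM bK cu.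
have w0l y : w 0 y = 0 := morphD0 (bformDl w y).
have w0r x : w x 0 = 0 := morphD0 (bformDr w x).
have cz z : Defs.center (heisenberg w) (0, 0, z).
  by move=> u; apply: heisenberg_commute; rewrite /= w0l w0r.
(* Independent of the representative, since [alpha] sends the center to the center, where the first
   two coordinates vanish. *)
pose kap (k : K) : zprod E F := (alpha (repr (k : center_quotient G))).1.
have kapE g : kap (center_pi g) = (alpha g).1.
  have := heisenberg_center sep (aC _ (repr_center_pi g)); rewrite aM aV /kap.
  case: (alpha g) (alpha (repr _)) => [[x y] z] [[x' y'] z'] /=.
  rewrite -[X in X = _ -> _]/(- x + x', - y + y') => -[ex ey].
  by congr (_, _); apply/eqP; rewrite -subr_eq0 addrC ?ex ?ey.
pose kap' (u : zprod E F) : K := center_pi (beta (u.1, u.2, 0)).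
have kapK : cancel kap kap'.
  move=> k; rewrite -[k]center_piK; set g := repr _; rewrite /kap' kapE; apply/center_piP.
  rewrite -[X in (_ * X)%g]aK; set v := alpha g; case: v => [[x y] z] /=.
  have -> : beta (x, y, z) = (beta (x, y, 0) * beta (0, 0, z))%g.
    rewrite -bM; congr beta; rewrite -[RHS]/(_, _, _) /= !addr0 add0r w0r addr0 //.
  by rewrite mulKg; exact/bC/cz.
have kap'K : cancel kap' kap by move=> [x y]; rewrite /kap' kapE bK.
have kapD : {morph kap : a b / a + b}.
  move=> a b; rewrite -[a]center_piK -[b]center_piK -(quotient_piD hG) !kapE aM.
  by case: (alpha _) (alpha _) => [[x y] z] [[x' y'] z'].
have kap'D : {morph kap' : a b / a + b} by move=> a b; apply: (can_inj kapK); rewrite kapD !kap'K.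
have fstc (X Y : topologicalType) : continuous (fun p : X * Y => p.1) by move=> p; exact: cvg_fst.
have sndc (X Y : topologicalType) : continuous (fun p : X * Y => p.2) by move=> p; exact: cvg_snd.
have kapc : continuous kap.
  apply/(@quotient_continuous G {eq_quot (center_equiv G)}%qT (zprod E F)).
  rewrite (_ : _ \o _ = fun g => (alpha g).1); first exact: (comp_continuous ac (@fstc _ _)).
  by apply/funext => g; exact: kapE.
have kap'c : continuous kap'.
  have c : continuous (fun u : zprod E F => (u.1, u.2, 0) : heisenberg w).
    apply: continuous_pair => u; last exact: cvg_cst.
    by move: u; apply: continuous_pair; [exact: fstc|exact: sndc].
  exact: (comp_continuous (comp_continuous c bc) (@center_pi_continuous G)).
pose iota (z : A) : circle R := zeta (center_elt (bC _ (cz z)) : center_group G).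
have iota_inj : injective iota.
  have [_ [z' [zK _ _ _]]] := zeta_iso.
  by move=> z t /(can_inj zK) /(congr1 (@center_val G)) /(can_inj bK) -[].
have iotaD : {morph iota : z t / z + t}.
  move=> z t; rewrite /iota -(chomD zeta); congr (zeta _); apply: (@center_val_inj G).
  rewrite /center_val /= -bM; congr beta.
  by rewrite -[RHS]/(_, _, _) /= !addr0 w0l addr0.
have iotac : continuous iota.
  apply: comp_continuous (@chom_continuous _ _ zeta); apply: continuous_to_center.
  have c : continuous (fun z : A => (0, 0, z) : heisenberg w).
    by apply: pair_continuous_r.
  exact: (comp_continuous c bc).
have nablaE u v : nabla (kap' u) (kap' v) = iota (w u.1 v.2) - iota (w v.1 u.2).
  rewrite mumford_dualE -(morphDB iotaD); congr (zeta _); apply: (@center_val_inj G).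
  apply: (can_inj aK); rewrite bK; rewrite /center_val /=.
  rewrite /commg /conjg !aM !aV !bK -[LHS]/[~ _, _]%g heisenberg_commg //.
have wfD y : {morph (fun x => iota (w x y)) : x x' / x + x'}.
  by move=> x x'; rewrite bformDl iotaD.
have wfc y : continuous (fun x => iota (w x y)).
  exact: (comp_continuous (comp_continuous (@pair_continuous_l E F y) (bform_continuous (b := w))) iotac).
pose wf y : dual R E := Chom (wfD y) (wfc y).
have wf_add : {morph wf : y y' / y + y'}.
  by move=> y y'; apply: chomP => x; rewrite chom_addE /wf /= -iotaD -bformDr.
have wf_inj : injective wf.
  move=> y y' yy'; apply/eqP; rewrite -subr_eq0; apply/eqP; apply: contrapT => /sep.2[x]; apply.
  apply: iota_inj; rewrite (morphD0 iotaD) -[LHS]/(wf (y - y') x).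
  by rewrite (morphDB wf_add) yy' subrr chom_zeroE.
have eD : {morph (fun x : E => kap' (x, 0)) : x x' / x + x'}.
  move=> x x'; rewrite -kap'D; congr kap'.
  by apply: injective_projections; rewrite /= ?addr0.
have ec : continuous (fun x : E => kap' (x, 0)) := comp_continuous (@pair_continuous_l E F 0) kap'c.
have pD : {morph (fun k => (kap k).1) : k k' / k + k'} by move=> k k'; rewrite kapD.
have pc : continuous (fun k => (kap k).1) := comp_continuous kapc (@fstc E F).
pose e : chom E K := Chom eD ec; pose p : chom K E := Chom pD pc.
have wfE y : wf y = - chom_comp (nabla (kap' (0, y))) e.
  apply: chomP => x; rewrite chom_oppE -[chom_comp _ _ x]/(nabla _ (kap' (x, 0))) nablaE /=.
  by rewrite w0l (morphD0 iotaD) sub0r opprK.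
have wf_cts : continuous wf.
  rewrite (_ : wf = fun y => - chom_comp (nabla (kap' (0, y))) e); last exact/funext.
  apply: comp_continuous (@opp_continuous (dual R E)).
  apply: comp_continuous (@chom_comp_continuous_r E K (circle R) e).
  exact: (comp_continuous (comp_continuous (@pair_continuous_r E F 0) kap'c) nc).
(* A character [f] of [E], pulled back along the projection [p], is [nabla k] for some [k]. Pairing
   [k] with [kap' (x, 0)] gives minus [iota (w x (kap k).2)], whence the sign. *)
pose V (f : dual R E) : F := - (kap (n' (chom_comp f p))).2.
have wfV : cancel V wf.
  move=> f; apply: chomP => x; rewrite /V (morphDN wf_add) chom_oppE.
  have := n'K (chom_comp f p); set k := n' _; move=> /(congr1 (fun h : dual R K => h (kap' (x, 0)))).
  rewrite -[RHS]/(f (kap (kap' (x, 0))).1) kap'K /= => <-.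
  by rewrite -[in RHS](kapK k) nablaE /= w0r (morphD0 iotaD) sub0r.
have VK : cancel wf V by move=> y; apply: wf_inj; exact: wfV.
have Vc : continuous V.
  apply: comp_continuous (@opp_continuous F).
  have := comp_continuous (@chom_comp_continuous_r K E (circle R) p) n'c.
  by move=> c; exact: (comp_continuous (comp_continuous c kapc) (@sndc E F)).
have eK : cancel (fun x : E => kap' (x, 0)) (fun k => (kap k).1) by move=> x; rewrite kap'K.
have hE : hausdorff_space E := injective_hausdorff hK ec (can_inj eK).
exists E.
  split=> //; apply: (locally_compact_open_image lcK hE pc); first by move=> U; exact: (split_epi_open pD ec eK).
  by move=> x; exists (kap' (x, 0)); rewrite kap'K.
pose phi (k : K) : zprod E (dual R E) := ((kap k).1, wf (kap k).2).
exists phi; split; last first.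
  move=> k l; rewrite -[in RHS](kapK k) -[in RHS](kapK l) nablaE //.
split; first by move=> k l; rewrite /phi kapD wf_add.
exists (fun u => kap' (u.1, V u.2)); split.
- by move=> k; rewrite /= VK -[RHS](kapK k); congr kap'; case: (kap k).
- by move=> [x f]; rewrite /phi kap'K /= wfV.
- by apply: continuous_pair; [exact: pc|exact: (comp_continuous (comp_continuous kapc (@sndc E F)) wf_cts)].
- apply: comp_continuous kap'c; apply: continuous_pair; first exact: fstc.
  exact: (comp_continuous (@sndc _ _) Vc).
Qed.

(* A point of [E] killed by all characters is central in the Mackey-Weil group;
   since the central circle of that group exhausts its center, it is [0]. *)
Lemma mackey_weil_heisenberg (E : topologicalZmodType) (hE : locally_compact_hausdorff E) :
  isomorphic_groups G (mackey_weil R hE) -> generalized_heisenberg G.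
Proof.
move=> Giso; exists E, (dual R E), (circle R), (evaluation_form R hE); split; last exact: Giso.
split=> [x x0|f f0]; last first.
  apply: contra_notP f0 => nx; apply: chomP => x; apply: contrapT => fx.
  by apply: nx; exists x.
have [alpha [aM [beta [aK bK ac bc]]]] := Giso.
set w := evaluation_form R hE in alpha aM beta aK bK ac bc *.
have bM : {morph beta : u v / (u * v)%g} by move=> u v; apply: (can_inj aK); rewrite aM !bK.
apply: contra_notP x0 => nf.
have w0l y : w 0 y = 0 := morphD0 (bformDl w y).
have w0r x' : w x' 0 = 0 := morphD0 (bformDr w x').
have wx f : w x f = 0 by apply: contrapT => fx; apply: nf; exists f.
have bC u : Defs.center (heisenberg w) u -> Defs.center G (beta u).
  by move=> cu g; apply: (can_inj aK); rewrite !aM bK cu.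
have cz z : Defs.center (heisenberg w) (0, 0, z).
  move=> u; apply: heisenberg_commute.
  by rewrite -[LHS]/(w 0 u.1.2) -[RHS]/(w u.1.1 0) w0l w0r.
have cx : Defs.center (heisenberg w) (x, 0, 0).
  move=> u; apply: heisenberg_commute.
  by rewrite -[LHS]/(w x u.1.2) -[RHS]/(w u.1.1 0) wx w0r.
have [zD [z' [zK _ zc _]]] := zeta_iso.
pose j (z : circle R) : circle R := zeta (center_elt (bC _ (cz z)) : center_group G).
(* Surjectivity of [j] yields a [z] for which the central elements [(0, 0, z)] and [(x, 0, 0)] have
   the same image under [zeta]; comparing coordinates gives [x = 0]. *)
have [|||z /(can_inj zK) /(congr1 (@center_val G)) /(can_inj bK) -[] //] :=
  @circle_endo_surjective R j _ _ _ (zeta (center_elt (bC _ cx) : center_group G)).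
- move=> z t; rewrite /j -zD; congr (zeta _); apply: (@center_val_inj G).
  rewrite /center_val /= -bM; congr beta.
  by rewrite -[RHS]/(0 + 0, 0 + 0, z + t + w 0 0) w0l !addr0.
- apply: comp_continuous zc; apply: continuous_to_center.
  have c : continuous (fun z : circle R => (0, 0, z) : heisenberg w).
    by apply: pair_continuous_r.
  exact: (comp_continuous c bc).
- by move=> z t /(can_inj zK) /(congr1 (@center_val G)) /(can_inj bK) -[].
Qed.

End Equivalences.

Theorem theorem6p5 (R : realType) (G : topologicalGroupType)
    (G_N2 : nilpotent2 G) (G_lc : locally_compact_hausdorff G)
    (G_mumford : mumford_group G_N2)
    (zeta : chom (additive_group (center_abelian G)) (circle R))
    (zeta_iso : zmod_isomorphism zeta) :
  (generalized_heisenberg G <->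
     standard_self_duality (mumford_dual G_N2 zeta)) /\
  (standard_self_duality (mumford_dual G_N2 zeta) <->
     exists (E : topologicalZmodType) (E_lca : locally_compact_hausdorff E),
       isomorphic_groups G (mackey_weil R E_lca)).
Proof.
have symp := mumford_symplectic zeta_iso G_lc.2 G_mumford.
have h12 (h : generalized_heisenberg G) := heisenberg_standard zeta_iso h symp.
have h23 := standard_mackey_weil (hG := G_N2) zeta_iso.
have h31 : (exists (E : topologicalZmodType) (hE : locally_compact_hausdorff E),
    isomorphic_groups G (mackey_weil R hE)) -> generalized_heisenberg G.
  by move=> [E [hE Giso]]; exact: (mackey_weil_heisenberg zeta_iso (hE := hE) Giso).
by split; split=> h; [exact: h12|exact/h31/h23|exact: h23|exact/h12/h31].
Qed.
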